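(* Let $q\geq 2$ be an integer and let $G$ be a finite forest with $|V(G)|\geq 2q+2$ that has a matching of size $q$. Then $S(\sigma_q\Delta(G))$ is Cohen-Macaulay if and only if $G$ is a path graph.
   Context: A forest is a graph without cycles (a disjoint union of trees). A matching of size $q$ is a set of $q$ pairwise vertex-disjoint edges. The clique complex $\Delta(G)$ is the simplicial complex on $V(G)$ whose faces are the cliques of $G$. For a simplicial complex $\Delta$ on $V$, $\sigma_q\Delta=\{F_1\cup\cdots\cup F_q : F_1,\dots,F_q\in\Delta\}$. Let $\Bbbk$ be a field. With $V=\{0,\dots,r\}$ and $S=\Bbbk[x_0,\dots,x_r]$ standard graded, $I(\Delta)=(\prod_{i\in W}x_i : W\subseteq V,\ W\notin\Delta)$ and $S(\Delta)=S/I(\Delta)$ (Stanley-Reisner ring). $S(\Delta)$ is Cohen-Macaulay if and only if its projective dimension over $S$ equals $\operatorname{codim}\Delta=|V|-\max_{F\in\Delta}|F|$. *)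

(* Defs.v *)
From HB Require Import structures.
From mathcomp Require Import all_boot all_order all_algebra perm.
From mathcomp Require Import boolp mpoly.
Import GRing.Theory.

Set Implicit Arguments.
Unset Strict Implicit.
Unset Printing Implicit Defensive.

Local Open Scope ring_scope.

(* A graph on the vertices 0, ..., n-1 is its adjacency relation, assumed
   symmetric and irreflexive where it is used. *)
Section Graphs.
Variables (n : nat) (e : rel 'I_n).

Definition simple_graph : Prop := ssrbool.symmetric e /\ irreflexive e.

(* [cycle e c] also holds for the empty sequence and for [:: x; y] with x, y
   adjacent; a cycle of a simple graph has length at least 3. *)
Definition forest : Prop :=
  simple_graph /\ forall c : seq 'I_n, cycle e c -> uniq c -> (size c < 3)%N.

Definition is_edge (E : {set 'I_n}) : Prop :=
  exists x y : 'I_n, e x y /\ E = [set x; y].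

Definition is_matching (M : {set {set 'I_n}}) : Prop :=
  (forall E, E \in M -> is_edge E) /\ trivIset M.

Definition has_matching_of_size (q : nat) : Prop :=
  exists2 M : {set {set 'I_n}}, is_matching M & #|M| = q.

Definition path_rel : rel 'I_n :=
  fun i j => (i.+1 == j :> nat) || (j.+1 == i :> nat).

Definition is_path_graph : Prop :=
  exists s : {perm 'I_n}, forall i j, e (s i) (s j) = path_rel i j.

Definition clique_complex : {set {set 'I_n}} :=
  [set F : {set 'I_n} |
     [forall x in F, forall y in F, (x != y) ==> e x y]].

End Graphs.

Section Complexes.
Variable n : nat.
Implicit Type D : {set {set 'I_n}}.

Definition simplicial_complex D : Prop :=
  set0 \in D /\ forall F F' : {set 'I_n}, F \in D -> F' \subset F -> F' \in D.

Definition secant_complex (q : nat) D : {set {set 'I_n}} :=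
  [set F : {set 'I_n} |
     [exists f : {ffun 'I_q -> {set 'I_n}},
        [forall i, f i \in D] && (F == \bigcup_i f i)]].

Definition codim D : nat := (n - \max_(F in D) #|F|)%N.

Lemma clique_complex_simplicial (e : rel 'I_n) :
  simplicial_complex (clique_complex e).
Proof.
split; first by rewrite inE; apply/forall_inP=> x; rewrite inE.
move=> F F'; rewrite !inE => /forall_inP hF /subsetP sF.
apply/forall_inP=> x /sF xF; apply/forall_inP=> y /sF yF.
exact: (forall_inP (hF x xF)).
Qed.

Lemma secant_complex_simplicial q D :
  simplicial_complex D -> simplicial_complex (secant_complex q D).
Proof.
move=> [D0 DS]; split=> [|F F'].
  rewrite inE; apply/existsP; exists [ffun=> set0].
  apply/andP; split; first by apply/forallP=> i; rewrite ffunE.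
  by apply/eqP; rewrite big1 // => i _; rewrite ffunE.
rewrite !inE => /existsP [f /andP [/forallP fD /eqP ->]] sF.
apply/existsP; exists [ffun i => f i :&: F']; apply/andP; split.
  by apply/forallP=> i; rewrite ffunE (DS _ _ (fD i)) // subsetIl.
apply/eqP/setP=> x; apply/idP/bigcupP => [xF'|[i _]].
  have /bigcupP [i _ xi] := subsetP sF _ xF'.
  by exists i => //; rewrite ffunE inE xi.
by rewrite ffunE inE => /andP [].
Qed.

End Complexes.

Section StanleyReisner.
Variables (k : fieldType) (n : nat) (D : {set {set 'I_n}}).
Local Notation S := {mpoly k[n]}.

Definition face_monomial (W : {set 'I_n}) : S := \prod_(i in W) 'X_i.

Definition SR_ideal : {pred S} :=
  [pred p : S | `[< exists c : {set 'I_n} -> S,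
                    p = \sum_(W : {set 'I_n} | W \notin D)
                           c W * face_monomial W >]].

Lemma SR_idealP (p : S) :
  reflect (exists c : {set 'I_n} -> S,
             p = \sum_(W : {set 'I_n} | W \notin D) c W * face_monomial W)
          (p \in SR_ideal).
Proof. exact: asboolP. Qed.

Lemma SR_ideal_zmod_closed : zmod_closed SR_ideal.
Proof.
split=> [|p r /SR_idealP [c ->] /SR_idealP [d ->]]; apply/SR_idealP.
  by exists (fun=> 0); rewrite big1 // => W _; rewrite mul0r.
exists (fun W => c W - d W); rewrite -sumrB.
by apply: eq_bigr => W _; rewrite mulrBl.
Qed.

Lemma SR_ideal_mull (a p : S) : p \in SR_ideal -> a * p \in SR_ideal.
Proof.
move=> /SR_idealP [c ->]; apply/SR_idealP; exists (fun W => a * c W).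
by rewrite mulr_sumr; apply: eq_bigr => W _; rewrite mulrA.
Qed.

HB.instance Definition _ := GRing.isZmodClosed.Build S SR_ideal
  SR_ideal_zmod_closed.

(* Only the S-module structure of S / I(D) is set up: the ring quotient of the
   library asks for a proper ideal, which I(D) is only when set0 \in D. *)
Definition SR_ring : Type := Quotient.quot SR_ideal.
HB.instance Definition _ := GRing.Zmodule.on SR_ring.

Definition SR_proj (p : S) : SR_ring := (\pi_(Quotient.quot SR_ideal) p)%qT.

Lemma SR_projD p r : SR_proj (p + r) = SR_proj p + SR_proj r.
Proof. exact: raddfD. Qed.

Lemma SR_proj_eq (p r : S) : SR_proj p = SR_proj r <-> p - r \in SR_ideal.
Proof.
rewrite /SR_proj; split=> [pr|]; first by rewrite Quotient.idealrBE pr.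
by rewrite Quotient.idealrBE => /eqP.
Qed.

Definition SR_scale (a : S) (x : SR_ring) : SR_ring :=
  SR_proj (a * repr (x : Quotient.quot SR_ideal)).

Lemma SR_scale_proj (a p : S) : SR_scale a (SR_proj p) = SR_proj (a * p).
Proof.
apply/SR_proj_eq; rewrite -mulrBr; apply: SR_ideal_mull.
by apply/SR_proj_eq; rewrite /SR_proj reprK.
Qed.

Lemma SR_proj_surj (x : SR_ring) : exists p, x = SR_proj p.
Proof.
by exists (repr (x : Quotient.quot SR_ideal)); rewrite /SR_proj reprK.
Qed.

Lemma SR_scaleA a b (x : SR_ring) :
  SR_scale a (SR_scale b x) = SR_scale (a * b) x.
Proof. by have [p ->] := SR_proj_surj x; rewrite !SR_scale_proj mulrA. Qed.

Lemma SR_scale1 : left_id 1 SR_scale.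
Proof. by move=> x; have [p ->] := SR_proj_surj x; rewrite SR_scale_proj mul1r. Qed.

Lemma SR_scaleDr : right_distributive SR_scale +%R.
Proof.
move=> a x y; have [p ->] := SR_proj_surj x; have [r ->] := SR_proj_surj y.
by rewrite -SR_projD !SR_scale_proj mulrDr SR_projD.
Qed.

Lemma SR_scaleDl (x : SR_ring) : {morph SR_scale^~ x : a b / a + b}.
Proof.
move=> a b /=; have [p ->] := SR_proj_surj x.
by rewrite !SR_scale_proj mulrDl SR_projD.
Qed.

HB.instance Definition _ := GRing.Zmodule_isLmodule.Build S SR_ring
  SR_scaleA SR_scale1 SR_scaleDr SR_scaleDl.

End StanleyReisner.

Section ProjectiveDimension.
Variable R : nzRingType.

Definition projective (P : lmodType R) : Prop :=
  forall (A B : lmodType R) (f : {linear A -> B}) (g : {linear P -> B}),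
    (forall b, exists a, f a = b) ->
    exists h : {linear P -> A}, forall x, f (h x) = g x.

Definition exact_at (A B C : lmodType R)
    (f : {linear A -> B}) (g : {linear B -> C}) : Prop :=
  forall b, g b = 0 <-> exists a, f a = b.

(* A projective resolution ... -> P 1 -> P 0 -> M -> 0 with P i = 0 for
   i > d. *)
Definition has_proj_resolution (M : lmodType R) (d : nat) : Prop :=
  exists (P : nat -> lmodType R) (delta : forall i, {linear P i.+1 -> P i})
         (eps : {linear P 0 -> M}),
    [/\ forall i, projective (P i),
        forall m, exists x, eps x = m,
        exact_at (delta 0) eps,
        forall i, exact_at (delta i.+1) (delta i)
      & forall i, (d < i)%N -> forall x : P i, x = 0].

Definition proj_dim_eq (M : lmodType R) (d : nat) : Prop :=
  has_proj_resolution M d /\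
  forall d', has_proj_resolution M d' -> (d <= d')%N.

End ProjectiveDimension.

(* For a Stanley-Reisner ring, which is graded, being Cohen-Macaulay is the
   equality of projective dimension over S and codimension
   (Auslander-Buchsbaum formula). *)
Definition SR_cohen_macaulay (k : fieldType) (n : nat)
    (D : {set {set 'I_n}}) : Prop :=
  proj_dim_eq (SR_ring k D : lmodType {mpoly k[n]}) (codim D).

(* Main.v *)
Require Import Defs.
From HB Require Import structures.
From mathcomp Require Import all_boot all_order all_algebra perm.
From mathcomp Require Import boolp mpoly freeg zify ring.
Import GRing.Theory.

Set Implicit Arguments.
Unset Strict Implicit.
Unset Printing Implicit Defensive.

Local Open Scope ring_scope.

(** Write sigma_q for the secant complex of the clique complex of a graph; in
    a forest its faces are the sets covered by q vertices or edges. A matching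
    of size q makes the codimension n - 2q, so the question is whether the
    projective dimension of S/I is exactly n - 2q.

    Upper bound for paths ([pd_initial_secant]). Multiplication by a variable
    x_v gives an exact sequence 0 -> S/(I : x_v) -> S/I -> S/(I + x_v) -> 0 of
    Stanley-Reisner rings, of the star and of the deletion of v
    ([SR_star_deletion]). For the last vertex v of a path on m vertices, the
    star is the complex of the path on m - 2 vertices with q - 1 cliques,
    because v is best covered together with its predecessor; the deletion is
    the complex of the path on m - 1 vertices, with one more variable killed.
    By induction on m both outer terms have projective dimension at most
    m - 2q, hence so has the middle one.

    Lower bounds ([pd_ge_link]). If the link of a face F has reduced cohomology
    in dimension i - 1, then every projective resolution of S/I has length at
    least n - |F| - i. Indeed a cocycle of the link gives a nonzero class of
    degree i in the Koszul cohomology of S/I on the n - |F| variables outside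
    F; on a projective module this cohomology vanishes below degree n - |F|
    ([projective_koszul_acyclic]), and passing from a module to a syzygy raises
    the degree of a class by one. With F a facet of size 2q and i = 0 this
    yields the bound n - 2q, which settles the case of paths.

    Forests that are not paths. Call a vertex set U obstructed if the complex
    of the graph induced on U has a face F with cohomology in the dimension
    i - 1 of its link and |F| + i < 2q; then the projective dimension is too
    large. An isolated vertex obstructs U, with F a maximal face through it and
    i = 0; so does a disconnection for q = 1, with i = 1; so does, for q = 2, a
    vertex v with three neighbours, with F = {v} and i = 2
    ([obstructed_branch]). When a v is a leaf edge, the link of {a, v} is the
    complex of U minus {a, v} with q - 1 cliques, so obstructions lift from
    there to U ([obstructed_leaf]). Peeling leaf edges therefore shows that an
    unobstructed U with at least 2q + 2 vertices is connected
    ([obstructed_separated]) and has a Hamiltonian path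
    ([traceable_of_not_obstructed]); a forest with a Hamiltonian path is that
    path. *)

(** * Projective dimension along short exact sequences *)

Section LinearMaps.
Variable R : nzRingType.

Definition mklin (U V : lmodType R) (f : U -> V) (lin_f : linear f) :
  {linear U -> V} := HB.pack f (GRing.isLinear.Build R U V *:%R f lin_f).

Definition kernel_pred (U V : lmodType R) (f : {linear U -> V}) : {pred U} :=
  [pred x | f x == 0].

Lemma kernel_submod (U V : lmodType R) (f : {linear U -> V}) :
  submod_closed (kernel_pred f).
Proof.
split; first by rewrite inE linear0.
by move=> a x y; rewrite !inE linearP => /eqP-> /eqP->; rewrite scaler0 addr0.
Qed.

HB.instance Definition _ U V f :=
  GRing.isSubmodClosed.Build R U (@kernel_pred U V f) (kernel_submod f).

Definition kernel (U V : lmodType R) (f : {linear U -> V}) : Type :=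
  {x : U | x \in kernel_pred f}.

HB.instance Definition _ U V f := [isSub of @kernel U V f for sval].
HB.instance Definition _ U V f := [Choice of @kernel U V f by <:].
HB.instance Definition _ U V f :=
  [SubChoice_isSubLmodule of @kernel U V f by <:].

End LinearMaps.

(** Locked, so that simplification does not unfold the inclusion to the
    underlying projection of a subtype. *)
HB.lock Definition kernel_incl (R : nzRingType) (U V : lmodType R)
    (f : {linear U -> V}) :
  {linear kernel f -> U} := \val.
Arguments kernel_incl {R U V} f.

Section KernelFactorization.
Variable R : nzRingType.


Lemma kernel_incl_inj (U V : lmodType R) (f : {linear U -> V}) :
  injective (kernel_incl f).
Proof. by rewrite kernel_incl.unlock; exact: val_inj. Qed.

Lemma kernelP (U V : lmodType R) (f : {linear U -> V}) (x : U) :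
  f x = 0 -> exists y : kernel f, kernel_incl f y = x.
Proof.
by rewrite kernel_incl.unlock => /eqP fx; exists (exist _ x fx).
Qed.

Lemma kernel_exact (U V : lmodType R) (f : {linear U -> V}) :
  exact_at (kernel_incl f) f.
Proof.
move=> x; split=> [/kernelP//|[y <-]].
by rewrite kernel_incl.unlock; have := valP y; rewrite inE => /eqP.
Qed.

(** The two universal properties through which all linear maps below arise:
    factoring through an injection and descending along a surjection. *)
Lemma factor_inj (K P X : lmodType R) (i : {linear K -> P})
    (t : {linear X -> P}) :
  injective i -> (forall x, exists y, i y = t x) ->
  exists t' : {linear X -> K}, forall x, i (t' x) = t x.
Proof.
move=> inj_i /choice [t' it']; have lin_t' : linear t'.
  by move=> a x y; apply: inj_i; rewrite linearP !it' linearP.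
by exists (mklin lin_t').
Qed.

Lemma factor_kernel (X U V : lmodType R) (f : {linear U -> V})
    (t : {linear X -> U}) :
  (forall x, f (t x) = 0) ->
  exists t' : {linear X -> kernel f}, forall x, kernel_incl f (t' x) = t x.
Proof.
move=> ft; apply: (factor_inj (i := kernel_incl f)).
  exact: kernel_incl_inj.
by move=> x; apply: kernelP.
Qed.

Lemma descend_surj (P M X : lmodType R) (p : {linear P -> M})
    (t : {linear P -> X}) :
  (forall y, exists x, p x = y) -> (forall x, p x = 0 -> t x = 0) ->
  exists t' : {linear M -> X}, forall x, t' (p x) = t x.
Proof.
move=> /choice [s ps] kert.
have tE x y : p x = p y -> t x = t y.
  by move=> pxy; apply/subr0_eq; rewrite -linearB kert // linearB pxy subrr.
have lin_t' : linear (t \o s).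
  by move=> a x y; rewrite /= -linearP; apply: tE; rewrite linearP !ps.
by exists (mklin lin_t') => x; apply: tE; rewrite ps.
Qed.

Lemma projective_retract (P M : lmodType R) (r : {linear P -> M})
    (s : {linear M -> P}) :
  (forall x, r (s x) = x) -> projective P -> projective M.
Proof.
move=> rs projP A B f g surj_f; have [h fh] := projP A B f (g \o r) surj_f.
by exists (h \o s) => x /=; rewrite fh /= rs.
Qed.

Lemma projective_prod (P Q : lmodType R) :
  projective P -> projective Q -> projective (P * Q)%type.
Proof.
move=> projP projQ A B f g surj_f.
have lin1 : linear (fun x : P => (x, 0) : P * Q).
  by move=> a x y; apply: injective_projections; rewrite /= ?scaler0 ?addr0.
have lin2 : linear (fun x : Q => (0, x) : P * Q).
  by move=> a x y; apply: injective_projections; rewrite /= ?scaler0 ?addr0.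
have [h1 fh1] := projP A B f (g \o mklin lin1) surj_f.
have [h2 fh2] := projQ A B f (g \o mklin lin2) surj_f.
have lin_h : linear (fun z : P * Q => h1 z.1 + h2 z.2).
  by move=> a x y; rewrite !linearP scalerDr addrACA.
exists (mklin lin_h) => -[x y] /=; rewrite linearD fh1 fh2 /= -linearD.
by congr (g (_, _)); rewrite ?addr0 ?add0r.
Qed.

Lemma projective_trivial (P : lmodType R) :
  (forall x : P, x = 0) -> projective P.
Proof.
move=> P0 A B f g _; have lin0 : linear (fun _ : P => 0 : A).
  by move=> a x y; rewrite scaler0 addr0.
by exists (mklin lin0) => x; rewrite (P0 x) !linear0.
Qed.

Lemma trivial_lmod : exists Z : lmodType R, forall x : Z, x = 0.
Proof.
exists (kernel (@idfun R^o : {linear R^o -> R^o})) => x.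
by apply: val_inj; have := valP x; rewrite inE => /eqP.
Qed.

Definition short_exact (A B C : lmodType R) (i : {linear A -> B})
    (p : {linear B -> C}) : Prop :=
  [/\ injective i, forall c, exists b, p b = c & exact_at i p].

(** Projective dimension at most [d], one syzygy at a time: the form in which
    both the exact sequences and the Koszul dimension shift can be inducted
    on. *)
Fixpoint pd_le (d : nat) (M : lmodType R) : Prop :=
  if d is d'.+1 then
    exists (P K : lmodType R) (i : {linear K -> P}) (p : {linear P -> M}),
      [/\ projective P, pd_le d' K & short_exact i p]
  else projective M.

Lemma kernel_short_exact (U V : lmodType R) (f : {linear U -> V}) :
  (forall y, exists x, f x = y) ->
  short_exact (kernel_incl f) f.
Proof.
by move=> surj_f; split=> //; [exact: kernel_incl_inj|exact: kernel_exact].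
Qed.

Lemma pd_leS d (M : lmodType R) : pd_le d M -> pd_le d.+1 M.
Proof.
elim: d M => [|d IHd] M /=; last first.
  by case=> P [K [i [p [projP /IHd pdK ses]]]]; exists P, K, i, p.
move=> projM; have [Z Z0] := trivial_lmod.
have lin0 : linear (fun _ : Z => 0 : M).
  by move=> a x y; rewrite scaler0 addr0.
exists M, Z, (mklin lin0), idfun; split=> //; first exact: projective_trivial.
split=> [x y _|y|x] /=; first by rewrite (Z0 x) (Z0 y).
  by exists y.
by split=> [->|[_ <-]//]; exists 0.
Qed.

(** The sum of a projective cover of the ends covers the middle, and the
    kernels again form a short exact sequence (horseshoe lemma). *)
Lemma pd_le_middle d (A B C : lmodType R) (i : {linear A -> B})
    (p : {linear B -> C}) :
  short_exact i p -> pd_le d A -> pd_le d C -> pd_le d B.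
Proof.
elim: d A B C i p => [|d IHd] A B C i p [inj_i surj_p exa] /=.
  move=> projA projC.
  have [s ps] := projC B C p idfun surj_p.
  have lin_t : linear (fun b => b - s (p b)).
    by move=> a x y; rewrite !linearP addrACA -scalerDr.
  have [b|r ir] := factor_inj (t := mklin lin_t) inj_i.
    by apply/exa; rewrite /= linearB ps subrr.
  have lin_f : linear (fun b => (r b, p b) : A * C).
    by move=> a x y; rewrite !linearP.
  have lin_g : linear (fun z : A * C => i z.1 + s z.2).
    by move=> a x y; rewrite !linearP scalerDr addrACA.
  apply: (@projective_retract _ _ (mklin lin_g) (mklin lin_f)).
    by move=> b /=; rewrite ir /= subrK.
  exact: projective_prod.
case=> [PA [KA [iA [pA [projPA pdKA [inj_iA surj_pA exA]]]]]].
case=> [PC [KC [iC [pC [projPC pdKC [inj_iC surj_pC exC]]]]]].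
have [t pt] := projPC B C p pC surj_p.
have lin_f : linear (fun z : PA * PC => i (pA z.1) + t z.2).
  by move=> a x y; rewrite !linearP scalerDr addrACA.
pose f : {linear (PA * PC)%type -> B} := mklin lin_f.
have surj_f b : exists z, f z = b.
  have [y py] := surj_pC (p b).
  have /exa [a ia] : p (b - t y) = 0 by rewrite linearB pt py subrr.
  by have [x px] := surj_pA a; exists (x, y); rewrite /= px ia subrK.
exists (PA * PC)%type, (kernel f), (kernel_incl f), f; split.
- exact: projective_prod.
- have lin1 : linear (fun k => (iA k, 0) : PA * PC).
    move=> a x y; apply: injective_projections; rewrite /= ?scaler0 ?addr0 //.
    exact: linearP.
  have [k|j valj] := @factor_kernel _ _ _ f (mklin lin1).
    by rewrite /= linear0 addr0 (iffRL (exA _)) ?linear0 //; exists k.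
  have lin2 : linear (fun z : kernel f => (kernel_incl f z).2).
    by move=> a x y; rewrite linearP.
  have [z|r iCr] := factor_inj (t := mklin lin2) inj_iC.
    apply/exC; rewrite /= -pt.
    have /= /eqP: f (kernel_incl _ z) = 0 by apply/kernel_exact; exists z.
    rewrite addrC addr_eq0 => /eqP->; rewrite linearN.
    by rewrite (iffRL (exa _)) ?oppr0 //; exists (pA (kernel_incl _ z).1).
  apply: (IHd _ _ _ j r _ pdKA pdKC); split=> [x y|k|z].
  + by move/(congr1 (kernel_incl f)); rewrite !valj => -[/inj_iA].
  + have /exa [a ia] : p (t (iC k)) = 0.
      by rewrite pt; apply/exC; exists k.
    have [x px] := surj_pA (- a).
    have [|z valz] := @kernelP _ _ f (x, iC k).
      by rewrite /= px linearN ia addNr.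
    by exists z; apply: inj_iC; rewrite iCr /= valz.
  + split=> [rz|[k <-]].
      have z2 : (kernel_incl _ z).2 = 0 by move: (iCr z); rewrite rz linear0.
      have fz : f (kernel_incl _ z) = 0 by apply/kernel_exact; exists z.
      move: fz; rewrite /= z2 linear0 addr0 => ipz.
      have /exA [k ik] : pA (kernel_incl _ z).1 = 0.
        by apply: inj_i; rewrite ipz linear0.
      exists k; apply: kernel_incl_inj; rewrite valj /= ik -z2.
      by case: (kernel_incl _ z).
    by apply: inj_iC; rewrite iCr linear0 /= valj.
- exact: kernel_short_exact.
Qed.

(** If P covers B with kernel K, then it covers C, with a kernel that extends
    A by K. *)
Lemma pd_le_right d (A B C : lmodType R) (i : {linear A -> B})
    (p : {linear B -> C}) :
  short_exact i p -> pd_le d A -> pd_le d.+1 B -> pd_le d.+1 C.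
Proof.
move=> [inj_i surj_p exa] pdA [P [K [iK [pB [projP pdK [inj_iK surj_pB exK]]]]]].
pose f : {linear P -> C} := p \o pB.
exists P, (kernel f), (kernel_incl f), f; split=> //; last first.
  apply: kernel_short_exact => c; have [b <-] := surj_p c.
  by have [x <-] := surj_pB b; exists x.
have [k|j valj] := @factor_kernel _ _ _ f iK.
  by rewrite /= (iffRL (exK _)) ?linear0 //; exists k.
pose pBv : {linear kernel f -> B} := pB \o kernel_incl f.
have [z|r ir] := factor_inj (t := pBv) inj_i.
  by apply/exa; apply/(kernel_exact f); exists z.
apply: (@pd_le_middle _ K _ A j r) => //; split=> [x y|a|z].
- by move/(congr1 (kernel_incl f)); rewrite !valj => /inj_iK.
- have [x px] := surj_pB (i a).
  have [|z valz] := @kernelP _ _ f x.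
    by rewrite /= px; apply/exa; exists a.
  by exists z; apply: inj_i; rewrite ir /= valz.
- split=> [rz|[k <-]].
    have /exK [k ik] : pB (kernel_incl _ z) = 0 by move: (ir z); rewrite rz linear0.
    by exists k; apply: kernel_incl_inj; rewrite valj.
  by apply: inj_i; rewrite ir linear0 /= valj; apply/exK; exists k.
Qed.

Lemma pd_le_resolution d (M : lmodType R) :
  pd_le d M <-> has_proj_resolution M d.
Proof.
split.
  elim: d M => [|d IHd] M /=.
    move=> projM; have [Z Z0] := trivial_lmod.
    pose P i : lmodType R := if i is _.+1 then Z else M.
    have lin0 (U V : lmodType R) : linear (fun _ : U => 0 : V).
      by move=> a x y; rewrite scaler0 addr0.
    exists P, (fun i => mklin (lin0 (P i.+1) (P i))), idfun; split.
    - by case=> [|i] //; apply: projective_trivial.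
    - by move=> m; exists m.
    - by move=> x; split=> [/= ->|[y <-]//]; exists 0.
    - by move=> i x; split=> [_|[y <-]//]; exists 0; rewrite [RHS]Z0.
    - by case=> [|i] // _ x; apply: Z0.
  case=> P0 [K [i [p [projP0 /IHd [P [delta [eps [projP surj_eps ex0 ex Pd]]]]]]]].
  move=> [inj_i surj_p exa].
  pose P' j : lmodType R := if j is j'.+1 then P j' else P0.
  pose delta' j : {linear P' j.+1 -> P' j} :=
    if j is j'.+1 return {linear P' j.+1 -> P' j} then delta j' else i \o eps.
  exists P', delta', p; split=> //.
  - by case.
  - move=> x; split=> [/exa [k <-]|[y <-]]; last by apply/exa; exists (eps y).
    by have [y <-] := surj_eps k; exists y.
  - case=> [|j] x /=; last exact: ex.
    rewrite -ex0; split=> [ix|->]; last by rewrite linear0.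
    by apply: inj_i; rewrite ix linear0.
  - by case=> [|j] //; rewrite ltnS; apply: Pd.
elim: d M => [|d IHd] M [P [delta [eps [projP surj_eps ex0 ex Pd]]]] /=.
  have inj_eps : injective eps.
    move=> x y /eqP; rewrite -subr_eq0 -linearB => /eqP /ex0 [z].
    by rewrite (Pd 1%N isT z) linear0 => /esym/subr0_eq.
  have [//|s eps_s] := @factor_inj _ _ _ eps (@idfun M) inj_eps.
  exact: (projective_retract (r := eps) eps_s).
exists (P 0%N), (kernel eps), (kernel_incl eps), eps.
split=> //; last exact: kernel_short_exact.
apply: IHd.
have [x|e' vale'] := @factor_kernel _ _ _ eps (delta 0%N).
  by apply/ex0; exists x.
exists (fun i => P i.+1), (fun i => delta i.+1), e'; split=> //.
- move=> z; have /ex0 [x dx] : eps (kernel_incl _ z) = 0.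
    by apply/kernel_exact; exists z.
  by exists x; apply: kernel_incl_inj; rewrite vale'.
- move=> x; rewrite -ex; split=> [e'x|dx].
    by rewrite -vale' e'x linear0.
  by apply: kernel_incl_inj; rewrite vale' dx linear0.
- by move=> i ltdi; apply: Pd; rewrite ltnS.
Qed.

End KernelFactorization.

(** * Stanley-Reisner rings *)

Section Monomials.
Variables (k : fieldType) (n : nat).
Local Notation S := {mpoly k[n]}.
Implicit Types (p : S) (m : 'X_{1..n}) (v w : 'I_n) (D : {set {set 'I_n}}).

Definition mnm_supp m : {set 'I_n} := [set i | (0 < m i)%N].

Lemma mcoeff_mulX p m m' :
  ('X_[m'] * p)@_m = if (m' <= m)%MM then p@_(m - m') else 0.
Proof.
rewrite mulrC; case: ifP => [le_m'm|not_le].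
  by rewrite -{1}(submK le_m'm) addmC mcoeffMX.
apply/eqP; rewrite mcoeff_eq0 (perm_mem (msuppMX _ _)); apply/mapP => -[m2 _ mE].
by move/negP: not_le; apply; apply/mnm_lepP => i; rewrite mE mnmDE leq_addr.
Qed.

Lemma mnm_supp_addU m v : mnm_supp (m + U_(v)) = v |: mnm_supp m.
Proof.
apply/setP=> i; rewrite !inE mnmDE mnm1E addn_gt0 lt0b orbC.
by rewrite (eq_sym v).
Qed.

Lemma mcoeff_mulU p m v :
  ('X_v * p)@_m = if v \in mnm_supp m then p@_(m - U_(v)) else 0.
Proof.
rewrite mcoeff_mulX inE; congr (if _ then _ else _).
apply/mnm_lepP/idP => [/(_ v)|mv i]; rewrite mnm1E ?eqxx //.
by case: eqP => // <-.
Qed.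

(** A left inverse of multiplication by x_v that commutes with the other
    variables; such operators express that the variables form a regular
    sequence, and they are inherited by direct sums and summands. *)
Definition divX v p : S :=
  \sum_(m <- msupp p | v \in mnm_supp m) p@_m *: 'X_[m - U_(v)].

Lemma mcoeff_divX v p m : (divX v p)@_m = p@_(m + U_(v)).
Proof.
have addU m' : v \in mnm_supp m' -> (m' - U_(v) + U_(v) = m')%MM.
  rewrite inE => m'v; apply: submK; apply/mnm_lepP => i; rewrite mnm1E.
  by case: eqP => // <-.
rewrite raddf_sum /=; under eq_bigr do rewrite mcoeffZ mcoeffX.
have [pm|/memN_msupp_eq0 pm] := boolP (m + U_(v) \in msupp p)%MM.
  rewrite big_mkcond (bigD1_seq _ pm) ?msupp_uniq //= mnm_supp_addU setU11.
  rewrite addmK eqxx mulr1 big1 ?addr0 // => m' neq_m'; case: ifP => // vm'.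
  have [m'E|_] := eqVneq (m' - U_(v))%MM m; last by rewrite mulr0.
  by rewrite -m'E addU ?eqxx in neq_m'.
rewrite pm big1_seq // => m' /andP [vm' _].
have [m'E|_] := eqVneq (m' - U_(v))%MM m; last by rewrite mulr0.
by rewrite -(addU m' vm') m'E pm mul0r.
Qed.

Lemma divX_is_additive v : zmod_morphism (divX v).
Proof.
by move=> p r; apply/mpolyP=> m; rewrite !(mcoeffB, mcoeff_divX).
Qed.

HB.instance Definition _ v :=
  GRing.isZmodMorphism.Build S S (divX v) (divX_is_additive v).

Lemma divXK v p : divX v ('X_v * p) = p.
Proof.
apply/mpolyP=> m; rewrite mcoeff_divX mcoeff_mulU mnm_supp_addU setU11.
by rewrite addmK.
Qed.

Lemma divX_mulX v w p : w != v -> divX v ('X_w * p) = 'X_w * divX v p.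
Proof.
move=> neq_wv; apply/mpolyP=> m; rewrite mcoeff_divX !mcoeff_mulU.
rewrite mcoeff_divX mnm_supp_addU in_setU1 (negbTE neq_wv) /=.
case: ifP => // wm; congr (_@_ _); apply/mnmP=> i.
rewrite !(mnmDE, mnmBE, mnm1E); case: (w =P i) => [<-|_]; last by rewrite !subn0.
by rewrite (eq_sym v) (negbTE neq_wv) !addn0.
Qed.

Definition down_closed D : Prop :=
  forall F F' : {set 'I_n}, F \in D -> F' \subset F -> F' \in D.

Definition mnm_of (W : {set 'I_n}) : 'X_{1..n} :=
  [multinom (i \in W : nat) | i < n].

Lemma face_monomialE (W : {set 'I_n}) : face_monomial k W = 'X_[mnm_of W].
Proof.
rewrite /face_monomial mpolyXE_id big_mkcond; apply: eq_bigr => i _.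
by rewrite mnmE; case: (i \in W); rewrite ?expr1 ?expr0.
Qed.

Lemma mnm_supp_of W : mnm_supp (mnm_of W) = W.
Proof. by apply/setP=> i; rewrite inE mnmE lt0b. Qed.

Lemma mnm_of_le W m : (mnm_of W <= m)%MM = (W \subset mnm_supp m).
Proof.
apply/mnm_lepP/subsetP=> [le_Wm i iW|subWm i].
  by rewrite inE; apply: leq_trans (le_Wm i); rewrite mnmE iW.
by rewrite mnmE; case: (boolP (i \in W)) => // /subWm; rewrite inE.
Qed.

(** The ideal is generated by monomials, and a set that contains a nonface is
    a nonface; so membership is decided monomial by monomial. *)
Lemma SR_ideal_coeff D p : down_closed D ->
  reflect (forall m, mnm_supp m \in D -> p@_m = 0) (p \in SR_ideal D).
Proof.
move=> downD; apply: (iffP (SR_idealP _ _)) => [[c ->] m mD|p0].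
  rewrite raddf_sum big1 //= => W notWD.
  rewrite mulrC face_monomialE mcoeff_mulX mnm_of_le; case: ifP => // subWm.
  by rewrite (downD _ _ mD subWm) in notWD.
exists (fun W => \sum_(m <- msupp p | mnm_supp m == W) p@_m *: 'X_[m - mnm_of W]).
rewrite {1}[p]mpolyE (bigID (fun m => mnm_supp m \in D)) /= big1 ?add0r.
  rewrite (partition_big mnm_supp (fun W => W \notin D)) //=.
  apply: eq_bigr => W notWD; rewrite mulr_suml; apply: congr_big => // m.
    by case: eqP => [->|]; rewrite ?andbT ?andbF // notWD.
  move=> /andP [_ /eqP mW]; rewrite face_monomialE -scalerAl -mpolyXD submK //.
  by rewrite mnm_of_le mW.
by move=> m /p0 ->; rewrite scale0r.
Qed.

Definition star v D : {set {set 'I_n}} := [set A | v |: A \in D].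
Definition deletion v D : {set {set 'I_n}} := [set A in D | v \notin A].

Lemma star_down v D : down_closed D -> down_closed (star v D).
Proof.
by move=> downD F F'; rewrite !inE => FD subF; apply: downD FD (setUS _ subF).
Qed.

Lemma deletion_down v D : down_closed D -> down_closed (deletion v D).
Proof.
move=> downD F F'; rewrite !inE => /andP [FD vF] subF.
by rewrite (downD _ _ FD subF); apply: contra vF; apply: subsetP.
Qed.

Lemma SR_proj0 D p : SR_proj D p = 0 <-> p \in SR_ideal D.
Proof.
have -> : (0 : SR_ring k D) = SR_proj D 0 by rewrite /SR_proj raddf0.
by rewrite SR_proj_eq subr0.
Qed.

Lemma SR_projZ D a p : SR_proj D (a * p) = a *: (SR_proj D p : SR_ring k D).
Proof. by rewrite -[RHS]/(SR_scale _ _) SR_scale_proj. Qed.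

Lemma SR_proj_linear D : linear (SR_proj D : S^o -> SR_ring k D).
Proof. by move=> a p r; rewrite SR_projD -SR_scale_proj. Qed.

Lemma SR_descend D (X : lmodType S) (t : {linear S^o -> X}) :
  (forall p, p \in SR_ideal D -> t p = 0) ->
  exists t' : {linear SR_ring k D -> X}, forall p, t' (SR_proj D p) = t p.
Proof.
move=> It; apply: (descend_surj (p := mklin (@SR_proj_linear D))).
  by move=> y; have [p ->] := SR_proj_surj y; exists p.
by move=> p /SR_proj0/It.
Qed.

(** The first map is multiplication by x_v: the ideal of the star is the colon
    ideal I : x_v, and that of the deletion is I + (x_v). *)
Lemma SR_star_deletion D v : down_closed D ->
  exists (i : {linear SR_ring k (star v D) -> SR_ring k D})
         (p : {linear SR_ring k D -> SR_ring k (deletion v D)}),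
    short_exact i p.
Proof.
move=> downD.
have in_star p : (p \in SR_ideal (star v D)) = ('X_v * p \in SR_ideal D).
  apply/(SR_ideal_coeff _ (star_down downD))/(SR_ideal_coeff _ downD) => p0 m.
  - move=> mD; rewrite mcoeff_mulU; case: ifP => // vm; apply: p0.
    rewrite inE; apply: downD mD _; apply/subsetP=> i; rewrite !inE.
    case: eqP => [->|_] /=; first by move: vm; rewrite inE.
    by move/leq_trans; apply; rewrite mnmBE leq_subr.
  - rewrite inE -mnm_supp_addU => /p0.
    by rewrite mcoeff_mulU mnm_supp_addU setU11 addmK.
have lin_mul : linear (fun p : S^o => SR_proj D ('X_v * p)).
  move=> a p r; rewrite mulrDr SR_projD; congr (_ + _).
  by rewrite -SR_projZ -[a *: p]/((a : S) * (p : S)) mulrCA.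
have [p|i iE] := SR_descend (D := star v D) (t := mklin lin_mul).
  by rewrite in_star => /SR_proj0.
have [p|q qE] := SR_descend (D := D)
    (t := mklin (@SR_proj_linear (deletion v D))).
  move=> /SR_ideal_coeff p0; apply/SR_proj0/SR_ideal_coeff.
    exact: deletion_down.
  by move=> m; rewrite inE => /andP [mD _]; apply: p0.
exists i, q; split.
- move=> x y /eqP; rewrite -subr_eq0 -linearB => /eqP.
  have [p pE] := SR_proj_surj (x - y); rewrite pE iE /= => /SR_proj0.
  by rewrite -in_star => /SR_proj0; rewrite -pE => /subr0_eq.
- by move=> y; have [p ->] := SR_proj_surj y; exists (SR_proj D p); rewrite qE.
- move=> y; have [p ->] := SR_proj_surj y; rewrite qE; split=> [|[z]] /=.
    move=> /SR_proj0/(SR_ideal_coeff _ (deletion_down downD)) p0.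
    exists (SR_proj _ (divX v p)); rewrite iE /=; apply/SR_proj_eq.
    apply/SR_ideal_coeff=> // m mD; rewrite mcoeffB mcoeff_mulU.
    case: (boolP (v \in mnm_supp m)) => vm.
      rewrite mcoeff_divX submK ?subrr //; apply/mnm_lepP=> j.
      by rewrite mnm1E; case: eqP => // <-; move: vm; rewrite inE.
    by rewrite sub0r p0 ?oppr0 // inE mD.
  have [r ->] := SR_proj_surj z; rewrite iE /= => /SR_proj_eq rp.
  apply/SR_proj0/SR_ideal_coeff; first exact: deletion_down.
  move=> m; rewrite inE => /andP [mD vm].
  have /SR_ideal_coeff/(_ _ mD) := rp; move=> /(_ downD).
  rewrite mcoeffB mcoeff_mulU (negbTE vm) sub0r => /eqP.
  by rewrite oppr_eq0 => /eqP.
Qed.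

Lemma pd_SR_star_deletion d D v : down_closed D ->
  pd_le d (SR_ring k (star v D) : lmodType S) ->
  pd_le d (SR_ring k (deletion v D) : lmodType S) ->
  pd_le d (SR_ring k D : lmodType S).
Proof.
by move=> /(SR_star_deletion v) [i [p]]; apply: pd_le_middle.
Qed.

(** If v is a cone point, x_v is a nonzerodivisor on S/I. *)
Lemma pd_SR_deletion_cone d D v : down_closed D -> star v D = D ->
  pd_le d (SR_ring k D : lmodType S) ->
  pd_le d.+1 (SR_ring k (deletion v D) : lmodType S).
Proof.
move=> /(SR_star_deletion v) [i [p ses]] starD pdD.
by apply: (pd_le_right ses); [rewrite starD|apply: pd_leS].
Qed.

Lemma pd_SR_full : pd_le 0 (SR_ring k [set: {set 'I_n}] : lmodType S).
Proof.
move=> A B f g surj_f; set D := setT; rewrite -/D in g *.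
have downD : down_closed D by move=> F F'; rewrite !inE.
have [a fa] := surj_f (g (SR_proj D 1)).
have lin_t : linear (fun p : S^o => p *: a).
  by move=> c p r; rewrite scalerDl -scalerA.
have [p|h hE] := SR_descend (D := D) (t := mklin lin_t).
  move=> /(SR_ideal_coeff _ downD) pI; suff -> : p = 0 by rewrite linear0.
  by apply/mpolyP=> m; rewrite pI ?inE ?mcoeff0.
exists h => x; have [p ->] := SR_proj_surj x.
by rewrite hE /= linearZ fa -linearZ /= -SR_projZ mulr1.
Qed.

End Monomials.

(** * Koszul cohomology and lower bounds *)

Section Koszul.
Variables (k : fieldType) (n : nat).
Local Notation S := {mpoly k[n]}.
Implicit Types (A B C F W : {set 'I_n}) (a b c w : 'I_n).

Definition rank_in b B : nat := #|[set c in B | (c < b)%N]|.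

Lemma rank_in_setD1 b c B : b \in B ->
  rank_in c B = (rank_in c (B :\ b) + (b < c))%N.
Proof.
move=> bB; rewrite /rank_in (cardsD1 b) !inE bB addnC.
congr (#|pred_of_set _| + _)%N.
by apply/setP=> d; rewrite !inE; case: eqP.
Qed.

Lemma rank_in_setU1_min w b A : (forall a, a \in A -> (w < a)%N) -> b \in A ->
  rank_in b (w |: A) = (rank_in b A).+1.
Proof.
move=> ltwA bA; rewrite (@rank_in_setD1 w) ?setU11 // setU1K ?ltwA ?addn1 //.
by apply/negP=> /ltwA; rewrite ltnn.
Qed.

Lemma rank_in_min w A : (forall a, a \in A -> (w < a)%N) ->
  rank_in w (w |: A) = 0%N.
Proof.
move=> ltwA; apply/eqP; rewrite cards_eq0; apply/eqP/setP=> a; rewrite !inE.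
case: eqP => [->|_] /=; first by rewrite ltnn.
by case: (boolP (a \in A)) => //= /ltwA/ltnW; rewrite leqNgt => /negbTE.
Qed.

Lemma setU1D1 w a A : a \in A -> w \notin A ->
  (w |: A) :\ a = w |: (A :\ a).
Proof.
move=> aA wA; rewrite setDUl; congr (_ :|: _); apply/setDidPl.
by rewrite disjoints1 inE; apply: contraNneq wA => ->.
Qed.

Section Cochains.
Variable N : lmodType S.
Implicit Types f g : {set 'I_n} -> N.

(** The Koszul differential; a cochain is a function on all sets of variables,
    and its degree appears only as the size of the sets it is evaluated on. *)
Definition koszul f B : N :=
  \sum_(b in B) ((-1) ^+ rank_in b B * 'X_b) *: f (B :\ b).

Lemma eq_koszul f g B : (forall b, b \in B -> f (B :\ b) = g (B :\ b)) ->
  koszul f B = koszul g B.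
Proof. by move=> eq_fg; apply: eq_bigr => b bB; rewrite eq_fg. Qed.

Lemma koszulD f g B : koszul (fun C => f C + g C) B = koszul f B + koszul g B.
Proof. by rewrite -big_split; apply: eq_bigr => b _; rewrite scalerDr. Qed.

Lemma koszulN f B : koszul (fun C => - f C) B = - koszul f B.
Proof. by rewrite -sumrN; apply: eq_bigr => b _; rewrite scalerN. Qed.

(** The terms that remove b and c in the two possible orders cancel. *)
Lemma koszul_koszul f B : koszul (koszul f) B = 0.
Proof.
pose t b c := ((-1) ^+ (rank_in b B + rank_in c (B :\ b)) * ('X_b * 'X_c) : S)
  *: f (B :\ b :\ c).
have tN b c : b \in B -> c \in B -> (b < c)%N -> t c b = - t b c.
  move=> bB cB ltbc; rewrite /t -scaleNr -mulNr; congr (_ *: f _); last first.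
    by rewrite setDDl setUC -setDDl.
  rewrite ['X_b * _]mulrC; congr (_ * _); rewrite -[RHS]mulN1r -exprS.
  rewrite (rank_in_setD1 c bB) (rank_in_setD1 b cB) ltbc ltnNge (ltnW ltbc) /=.
  by congr (_ ^+ _); rewrite addn1 addn0 addSn addnC.
have -> : koszul (koszul f) B =
    \sum_(b in B) \sum_(c in B | (c < b)%N || (b < c)%N) t b c.
  apply: eq_bigr => b bB; rewrite scaler_sumr; apply: eq_big => [c|c _].
    by rewrite !inE -neq_ltn andbC.
  by rewrite scalerA mulrACA -exprD.
rewrite (eq_bigr (fun b => \sum_(c in B | (c < b)%N) t b c +
                           \sum_(c in B | (b < c)%N) t b c)) => [|b _].
  rewrite big_split (exchange_big_dep (mem B)) /= => [|b c _ /andP [] //].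
  rewrite -big_split big1 //= => c cB.
  rewrite (eq_bigl (fun b => (b \in B) && (c < b)%N)) => [|b]; last by rewrite cB.
  by rewrite -big_split big1 // => b /andP [bB ltcb] /=; rewrite (tN c b) ?addNr.
rewrite (bigID (fun c => (c < b)%N)) /=; congr (_ + _); apply: eq_bigl => c.
  by case: ltngtP; rewrite ?andbT ?andbF.
by case: ltngtP; rewrite ?andbT ?andbF.
Qed.

(** Joining a vertex below all others splits off the first term. *)
Lemma koszul_setU1_min w f A : (forall a, a \in A -> (w < a)%N) ->
  koszul f (w |: A) = 'X_w *: f A - koszul (fun C => f (w |: C)) A.
Proof.
move=> ltwA; have wA : w \notin A by apply/negP=> /ltwA; rewrite ltnn.
rewrite /koszul big_setU1 //= setU1K // rank_in_min // mul1r -sumrN.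
congr (_ + _); apply: eq_bigr => a aA.
by rewrite rank_in_setU1_min // exprS mulN1r mulNr scaleNr setU1D1.
Qed.

(** Exactness in degree i of the Koszul complex on the variables of W. *)
Definition koszul_acyclic W i : Prop := forall f,
  (forall B, B \subset W -> #|B| = i.+1 -> koszul f B = 0) ->
  exists g, forall A, A \subset W -> #|A| = i -> f A = koszul g A.

Definition divides_by w (delta : N -> N) : Prop :=
  [/\ zmod_morphism delta, forall x, delta ('X_w *: x) = x &
      forall b x, b != w -> delta ('X_b *: x) = 'X_b *: delta x].

(** On cochains, division by the least variable w of W is a contracting
    homotopy away from the sets containing w; what is left is a cochain for
    W minus w, of one degree less. *)
Lemma koszul_acyclic_division W i :
  (forall w, exists delta, divides_by w delta) ->
  (i < #|W|)%N -> koszul_acyclic W i.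
Proof.
move=> divN; move: {2}#|W| (erefl #|W|) => s; elim: s W i => [|s IHs] W i cardW.
  by rewrite cardW.
rewrite cardW => lti f df.
have [w0 w0W] : exists w, w \in W by apply/card_gt0P; rewrite cardW.
have [w wW minw] := arg_minnP (fun w : 'I_n => w : nat) w0W.
have {}wW : w \in W by [].
have ltw A : A \subset W -> w \notin A -> forall a, a \in A -> (w < a)%N.
  move=> subA wA a aA; have := minw a (subsetP subA a aA).
  by rewrite leq_eqVlt => /orP [/eqP/val_inj wa|//]; rewrite wa aA in wA.
have addW A : A \subset W -> w |: A \subset W.
  by rewrite subUset sub1set => ->; rewrite andbT.
have [delta [deltaB deltaX deltaC]] := divN w.
pose deltaZ : {additive N -> N} :=
  HB.pack delta (GRing.isZmodMorphism.Build N N delta deltaB).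
pose h C := if w \in C then 0 else delta (f (w |: C)).
have koszul_h A : A \subset W -> w \notin A -> #|A| = i -> koszul h A = f A.
  move=> subA wA cardA; rewrite -[RHS]deltaX.
  (* the cocycle condition on A with w added *)
  have -> : 'X_w *: f A = koszul (fun C => f (w |: C)) A.
    apply/subr0_eq; rewrite -koszul_setU1_min; last exact: ltw.
    by apply: df; rewrite ?addW // cardsU1 wA cardA.
  rewrite -[delta]/(deltaZ : N -> N) raddf_sum; apply: eq_bigr => a aA.
  have neq_aw : a != w by apply: contraNneq wA => <-.
  rewrite -!scalerA -signr_odd !scaler_sign /h !inE (negbTE wA) andbF.
  by case: odd; rewrite ?raddfN /= ?deltaC.
have [g fg] : exists g, forall A, A \subset W -> #|A| = i ->
    f A - koszul h A = koszul g A.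
  case: i => [|i] in lti f df h koszul_h *.
    exists (fun _ => 0) => A subA /eqP; rewrite cards_eq0 => /eqP A0.
    rewrite koszul_h ?A0 ?inE ?cards0 ?sub0set //.
    by rewrite subrr /koszul big_set0.
  pose f' A := f A - koszul h A.
  have df' B : B \subset W -> #|B| = i.+2 -> koszul f' B = 0.
    by move=> subB cardB; rewrite koszulD koszulN koszul_koszul subr0 df.
  have f'0 A : A \subset W -> w \notin A -> #|A| = i.+1 -> f' A = 0.
    by move=> subA wA cardA; rewrite /f' koszul_h ?subrr.
  have cardW' : #|W :\ w| = s by move: cardW; rewrite (cardsD1 w) wW => -[].
  have subW' A : A \subset W :\ w -> A \subset W /\ w \notin A.
    by rewrite subsetD1 => /andP.
  have [||psi psiE] := IHs (W :\ w) i cardW' _ (fun C => f' (w |: C)).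
  - by rewrite cardW'.
  - move=> B /subW' [subB wB] cardB.
    have : koszul f' (w |: B) = 0.
      by apply: df'; rewrite ?addW // cardsU1 wB cardB.
    rewrite koszul_setU1_min; last exact: ltw.
    by rewrite f'0 // scaler0 sub0r => /eqP; rewrite oppr_eq0 => /eqP.
  - exists (fun C => if w \in C then - psi (C :\ w) else 0) => A subA cardA.
    rewrite -/(f' A); have [wA|wA] := boolP (w \in A); last first.
      rewrite f'0 //; symmetry; apply: big1 => a _.
      by rewrite !inE (negbTE wA) andbF scaler0.
    have subA' : A :\ w \subset W :\ w by apply: setSD.
    have [subA'W wA'] := subW' _ subA'.
    rewrite -(setD1K wA) koszul_setU1_min; last exact: ltw.
    rewrite (negbTE wA') scaler0 sub0r psiE //; last first.
      by move: cardA; rewrite (cardsD1 w) wA => -[].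
    rewrite -koszulN; apply: eq_koszul => a aA'.
    by rewrite setU11 opprK setU1K // in_setD1 negb_and wA' orbT.
exists (fun C => h C + g C) => A subA cardA.
by rewrite koszulD -fg // addrC subrK.
Qed.

End Cochains.
Lemma linear_koszul (M N : lmodType S) (t : {linear M -> N}) f B :
  koszul (fun C => t (f C)) B = t (koszul f B).
Proof. by rewrite linear_sum; apply: eq_bigr => b _; rewrite linearZ. Qed.

Lemma divides_retract (P Q : lmodType S) (r : {linear P -> Q})
    (s : {linear Q -> P}) w (delta : P -> P) :
  (forall x, r (s x) = x) -> divides_by w delta ->
  divides_by w (fun x => r (delta (s x))).
Proof.
move=> rs [deltaB deltaX deltaC]; split=> [x y|x|b x neq_bw].
- by rewrite linearB deltaB linearB.
- by rewrite linearZ deltaX rs.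
- by rewrite linearZ deltaC // linearZ.
Qed.

Section FreeModule.
Variable K : choiceType.
Local Notation F := {freeg K / S}.

Definition free_divX w (x : F) : F :=
  \sum_(z <- dom x) << divX w (coeff z x) *g z >>.

Lemma coeff_free_divX w x z : coeff z (free_divX w x) = divX w (coeff z x).
Proof.
rewrite raddf_sum; under eq_bigr do rewrite /= coeffU.
have [zx|zx] := boolP (z \in dom x).
  rewrite (bigD1_seq _ zx) ?uniq_dom //= eqxx mulr1 big1 ?addr0 // => y.
  by move/negbTE=> ->; rewrite mulr0.
rewrite (coeff_outdom zx) raddf0 big1_seq // => y /andP [_ yx].
by case: eqP => [yz|]; rewrite ?mulr0 // -yz yx in zx *.
Qed.

Lemma divides_free w : divides_by w (free_divX w).
Proof.
split=> [x y|x|b x neq_bw]; apply/eqP/freeg_eqP => z.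
- by rewrite coeffB !coeff_free_divX coeffB raddfB.
- by rewrite coeff_free_divX coeffZ divXK.
- by rewrite coeff_free_divX !coeffZ coeff_free_divX divX_mulX.
Qed.

End FreeModule.

Lemma free_cover (P : lmodType S) :
  exists f : {linear {freeg P / S} -> P}, forall y, exists x, f x = y.
Proof.
have fgB : zmod_morphism (@fglift S P P id) by apply: lift_is_additive.
pose fgA : {additive {freeg P / S} -> P} :=
  HB.pack (@fglift S P P id) (GRing.isZmodMorphism.Build _ _ _ fgB).
have lin_f : linear (@fglift S P P id).
  move=> c x y; rewrite -[fglift _]/(fgA : _ -> _) raddfD; congr (_ + _).
  rewrite -[c *: x]/(fgscale c x) -[in RHS](freeg_sumE x) !raddf_sum.
  by apply: eq_bigr => z _; rewrite /= !liftU scalerA.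
exists (mklin lin_f) => y; exists << 1 *g y >>.
by rewrite /= liftU scale1r.
Qed.

(** A projective module is a summand of a free module, which has divisions
    coefficientwise whatever its rank. *)
Lemma projective_koszul_acyclic (P : lmodType S) W i :
  projective P -> (i < #|W|)%N -> koszul_acyclic P W i.
Proof.
move=> projP; apply: koszul_acyclic_division => w.
have [r surj_r] := free_cover P.
have [s rs] := projP _ _ r idfun surj_r.
by exists (fun x => r (free_divX w (s x))); apply/divides_retract/divides_free.
Qed.

(** A cocycle of M lifts to a cochain of P whose coboundary is a cocycle of K
    of the next degree (the connecting map). *)
Lemma koszul_acyclic_shift (K P M : lmodType S) (i : {linear K -> P})
    (p : {linear P -> M}) W j :
  short_exact i p -> koszul_acyclic P W j -> koszul_acyclic K W j.+1 ->
  koszul_acyclic M W j.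
Proof.
move=> [inj_i surj_p exi] acP acK f df.
have /choice [l pl] := surj_p.
have [u uE] : exists u : {set 'I_n} -> K, forall B, B \subset W -> #|B| = j.+1 ->
    i (u B) = koszul (fun C => l (f C)) B.
  suff /choice [u uE] : forall B, exists x, B \subset W -> #|B| = j.+1 ->
      i x = koszul (fun C => l (f C)) B by exists u.
  move=> B; have [[subB cardB]|notB] := pselect (B \subset W /\ #|B| = j.+1).
    have [|x ix] := (exi (koszul (fun C => l (f C)) B)).1; last by exists x.
    rewrite -linear_koszul -(df B) //.
    by apply: eq_koszul => b _; rewrite pl.
  by exists 0 => subB cardB; case: notB.
have [B subB cardB|v vE] := acK u.
  apply: inj_i; rewrite linear0 -linear_koszul.
  rewrite (eq_koszul (g := koszul (fun C => l (f C)))) ?koszul_koszul // => b bB.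
  rewrite uE ?(subset_trans (subD1set _ _)) //.
  by move: cardB; rewrite (cardsD1 b) bB => -[].
have [B subB cardB|g gE] := acP (fun C => l (f C) - i (v C)).
  by rewrite koszulD koszulN linear_koszul -vE // uE // subrr.
exists (fun C => p (g C)) => A subA cardA.
rewrite linear_koszul -gE // linearB pl (iffRL (exi _)) ?subr0 //.
by exists (v A).
Qed.

(** Each syzygy costs one degree of exactness. *)
Lemma pd_le_koszul_acyclic d (M : lmodType S) W i :
  pd_le d M -> (i + d < #|W|)%N -> koszul_acyclic M W i.
Proof.
elim: d M i => [|d IHd] M i /=.
  by rewrite addn0; apply: projective_koszul_acyclic.
case=> P [K [j [p [projP pdK ses]]]] ltid.
apply: (koszul_acyclic_shift ses).
  by apply: projective_koszul_acyclic => //; apply: leq_ltn_trans ltid;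
    apply: leq_addr.
by apply: IHd pdK _; rewrite addSnnS.
Qed.

Definition coboundary (phi : {set 'I_n} -> k) B : k :=
  \sum_(b in B) (-1) ^+ rank_in b B * phi (B :\ b).

(** Reduced simplicial cohomology in terms of the sizes of the faces: the
    degree [i] group is the reduced cohomology in dimension [i - 1]. *)
Definition cohomology_nonzero (L : {set {set 'I_n}}) i : Prop :=
  exists2 phi : {set 'I_n} -> k,
    forall B, B \in L -> #|B| = i.+1 -> coboundary phi B = 0 &
    ~ exists gamma, forall A, A \in L -> #|A| = i -> phi A = coboundary gamma A.

Definition link (D : {set {set 'I_n}}) F : {set {set 'I_n}} :=
  [set A : {set _} | [disjoint A & F] && (A :|: F \in D)].

(** A cocycle phi on the link of F makes A |-> phi(A) x_(A u F) a Koszul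
    cocycle of S/I on the variables outside F; reading off the coefficient of
    x_(A u F) turns a primitive of it into a primitive of phi. *)
Lemma pd_ge_link (D : {set {set 'I_n}}) F i d :
  down_closed D -> cohomology_nonzero (link D F) i ->
  pd_le d (SR_ring k D : lmodType S) -> (n <= d + i + #|F|)%N.
Proof.
move=> downD [phi dphi not_cob] pdD; rewrite leqNgt; apply/negP=> ltn.
case: not_cob; pose mon A := mnm_of (A :|: F).
have ltW : (i + d < #|~: F|)%N.
  by rewrite cardsCs setCK card_ord ltn_subRL addnC [(i + d)%N]addnC.
have monD1 B b : b \in B -> B \subset ~: F -> (mon B = U_(b) + mon (B :\ b))%MM.
  move=> bB; rewrite -disjoints_subset => disjBF; apply/mnmP=> j.
  rewrite mnmDE mnm1E !mnmE !inE; case: (eqVneq b j) => [<-|//].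
  by rewrite bB (disjointFr disjBF bB).
(* the Koszul cochain attached to phi *)
pose f A := SR_proj D (phi A *: 'X_[mon A]) : SR_ring k D.
have fE B : B \subset ~: F ->
    koszul f B = SR_proj D (coboundary phi B *: 'X_[mon B]).
  move=> subB; rewrite scaler_suml /SR_proj raddf_sum; apply: eq_bigr => b bB.
  rewrite -SR_projZ; congr SR_proj.
  rewrite (monD1 B b) // mpolyXD -!mul_mpolyC mpolyCM rmorph_sign.
  by rewrite -!mulrA; congr (_ * _); rewrite mulrCA.
have acyclic : koszul_acyclic (SR_ring k D) (~: F) i.
  exact: pd_le_koszul_acyclic pdD ltW.
have [B subB cardB|g gE] := acyclic f.
  rewrite fE //; apply/SR_proj0.
  have [BFD|BFD] := boolP (B :|: F \in D).
    by rewrite dphi ?scale0r ?rpred0 // inE disjoints_subset subB.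
  apply/(SR_ideal_coeff _ downD) => m mD; rewrite mcoeffZ mcoeffX.
  case: eqP => [mE|_]; last by rewrite mulr0.
  by rewrite -mE mnm_supp_of (negbTE BFD) in mD.
have /choice [g' g'E] : forall C, exists q, g C = SR_proj D q.
  by move=> C; apply: SR_proj_surj.
exists (fun C => (g' C)@_(mon C)) => A; rewrite inE => /andP [disjAF AFD] cardA.
have subA : A \subset ~: F by rewrite -disjoints_subset.
have /SR_proj_eq/(SR_ideal_coeff _ downD)/(_ (mon A)) :
    SR_proj D (phi A *: 'X_[mon A]) =
    SR_proj D (\sum_(a in A) ((-1) ^+ rank_in a A * 'X_a) * g' (A :\ a)).
  rewrite -/(f A) gE // /SR_proj raddf_sum; apply: eq_bigr => a _.
  by rewrite g'E -SR_projZ.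
rewrite mnm_supp_of AFD => /(_ isT); rewrite mcoeffB => /subr0_eq.
rewrite mcoeffZ mcoeffX eqxx mulr1 => ->; rewrite raddf_sum.
apply: eq_bigr => a aA /=.
rewrite -mulrA -(rmorph_sign (@mpolyC n k)) mcoeffCM (monD1 A a) //.
by rewrite ['X_a * _]mulrC mcoeffMX.
Qed.

End Koszul.

(** * Cohomology in low degrees *)

Section Cohomology.
Variables (k : fieldType) (n : nat).
Implicit Types (A B C F : {set 'I_n}) (L : {set {set 'I_n}}) (a b c : 'I_n).

(** Joining a vertex below all others splits off the first term, as for the
    Koszul differential. *)
Lemma coboundary_setU1_min (phi : {set 'I_n} -> k) a A :
  (forall b, b \in A -> (a < b)%N) ->
  coboundary phi (a |: A) = phi A - coboundary (fun C => phi (a |: C)) A.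
Proof.
move=> ltaA; have aA : a \notin A by apply/negP=> /ltaA; rewrite ltnn.
rewrite /coboundary big_setU1 //= setU1K // rank_in_min // mul1r -sumrN.
congr (_ + _); apply: eq_bigr => b bA.
by rewrite rank_in_setU1_min // exprS mulN1r mulNr setU1D1.
Qed.

Lemma coboundary_set1 (phi : {set 'I_n} -> k) a : coboundary phi [set a] = phi set0.
Proof.
rewrite -[[set a]]setU0 coboundary_setU1_min => [|b]; last by rewrite inE.
by rewrite /coboundary big_set0 subr0.
Qed.

Lemma coboundary_set2 (phi : {set 'I_n} -> k) a b : (a < b)%N ->
  coboundary phi [set a; b] = phi [set b] - phi [set a].
Proof.
move=> ltab; rewrite coboundary_setU1_min => [|c /set1P->//].
by rewrite coboundary_set1 setU0.
Qed.

Lemma coboundary_set3 (phi : {set 'I_n} -> k) a b c : (a < b)%N -> (b < c)%N ->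
  coboundary phi (a |: [set b; c]) =
  phi [set b; c] - phi [set a; c] + phi [set a; b].
Proof.
move=> ltab ltbc; rewrite coboundary_setU1_min => [|d].
  by rewrite coboundary_set2 // opprB addrA addrAC.
by case/set2P=> -> //; apply: ltn_trans ltbc.
Qed.

Lemma cards2_lt B : #|B| = 2 -> exists a b, (a < b)%N /\ B = [set a; b].
Proof.
move/eqP/cards2P=> [a [b [neq_ab ->]]].
case: (ltngtP a b) => [ltab|ltba|/val_inj eqab].
- by exists a, b; split.
- by exists b, a; split=> //; rewrite setUC.
- by rewrite eqab eqxx in neq_ab.
Qed.

Lemma cards3_lt B : #|B| = 3 ->
  exists a b c, [/\ (a < b)%N, (b < c)%N & B = a |: [set b; c]].
Proof.
move=> cardB; have /card_gt0P [a0 a0B] : (0 < #|B|)%N by rewrite cardB.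
have [a aB mina] := arg_minnP (fun a : 'I_n => a : nat) a0B.
have {}aB : a \in B by [].
have /cards2_lt [b [c [ltbc BE]]] : #|B :\ a| = 2.
  by move: cardB; rewrite (cardsD1 a) aB => -[].
exists a, b, c; split=> //; last by rewrite -BE setD1K.
have : b \in B :\ a by rewrite BE set21.
rewrite in_setD1 => /andP [neq_ba /mina].
rewrite leq_eqVlt => /orP [/eqP/val_inj ab|//].
by rewrite ab eqxx in neq_ba.
Qed.

(** A facet: the reduced cohomology of the complex {set0} in dimension -1. *)
Lemma cohomology_facet L :
  set0 \in L -> (forall A, A \in L -> A = set0) -> cohomology_nonzero k L 0.
Proof.
move=> L0 only0; exists (fun _ => 1) => [B /only0 ->|[gamma]].
  by rewrite cards0.
move/(_ set0 L0); rewrite cards0 => /(_ erefl) /eqP.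
by rewrite /coboundary big_set0 oner_eq0.
Qed.

(** The indicator of a union of components is a cocycle; it is not constant. *)
Lemma cohomology_disconnected L (X : {set 'I_n}) x y :
  [set x] \in L -> [set y] \in L -> x \in X -> y \notin X ->
  (forall a b, [set a; b] \in L -> (a \in X) = (b \in X)) ->
  cohomology_nonzero k L 1.
Proof.
move=> xL yL xX yX eqX; exists (fun A => (A \subset X)%:R) => [B BL|[gamma gE]].
  move=> /cards2_lt [a [b [ltab BE]]]; rewrite BE coboundary_set2 // !sub1set.
  by rewrite (eqX a b) ?subrr // -BE.
have := gE _ xL; have := gE _ yL; rewrite !cards1 !sub1set xX (negbTE yX).
rewrite !coboundary_set1 => /(_ erefl) <- /(_ erefl) /eqP.
by rewrite oner_eq0.
Qed.

(** On a pair this is the value of [omega] at its increasing enumeration. *)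
Definition cochain2 (omega : 'I_n -> 'I_n -> k) A : k :=
  \sum_(a in A) \sum_(b in A | (a < b)%N) omega a b.

Lemma cochain2E omega a b : (a < b)%N -> cochain2 omega [set a; b] = omega a b.
Proof.
move=> ltab; have neq_ab : a != b by apply: contraTneq ltab => ->; rewrite ltnn.
rewrite /cochain2 big_setU1 ?inE //= big_set1 [X in _ + X]big1 ?addr0 => [|c].
  rewrite (big_pred1 b) // => c; rewrite !inE.
  have [->|_] := eqVneq c a; first by rewrite ltnn andbF (negbTE neq_ab).
  by have [->|] := eqVneq c b; rewrite ?ltab.
by rewrite !inE => /andP [/orP [] /eqP->]; rewrite ?ltnn // ltnNge ltnW.
Qed.

(** For alternating [omega], the value of the coboundary on a triangle is, up
    to sign, the sum of [omega] around it, in whatever order the triangle is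
    run through; so a cocycle with nonzero sum around a loop of three edges is
    not a coboundary. *)
Lemma cohomology_cochain2 L (omega : 'I_n -> 'I_n -> k) x1 x2 x3 :
  (forall a b, omega b a = - omega a b) ->
  (forall B, B \in L -> #|B| = 3 -> exists x y z,
     B = [set x; y; z] /\ omega x y + omega y z + omega z x = 0) ->
  x1 != x2 -> x2 != x3 -> x3 != x1 ->
  [set x1; x2] \in L -> [set x2; x3] \in L -> [set x3; x1] \in L ->
  omega x1 x2 + omega x2 x3 + omega x3 x1 != 0 ->
  cohomology_nonzero k L 2.
Proof.
move=> omegaN cyc x12 x23 x31 L12 L23 L31 nz.
exists (cochain2 omega) => [B BL cardB|[gamma gE]].
  have [a [b [c [ltab ltbc BE]]]] := cards3_lt cardB.
  have [x [y [z [BE' cyc0]]]] := cyc B BL cardB.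
  rewrite BE coboundary_set3 // !cochain2E //; last exact: ltn_trans ltbc.
  have : [/\ a \in B, b \in B & c \in B] by rewrite BE !inE !eqxx ?orbT.
  have neq_ab : a != b by apply: contraTneq ltab => ->; rewrite ltnn.
  have neq_bc : b != c by apply: contraTneq ltbc => ->; rewrite ltnn.
  have neq_ac : a != c.
    by apply: contraTneq (ltn_trans ltab ltbc) => ->; rewrite ltnn.
  have -> : omega b c - omega a c + omega a b = omega a b + omega b c + omega c a.
    by rewrite (omegaN a c); ring.
  rewrite BE' !inE -!orbA => -[].
  (* of the 27 ways to place a, b, c among x, y, z, six are injective *)
  do 3![case/or3P=> /eqP ?]; subst a b c;
    rewrite ?eqxx // in neq_ab neq_bc neq_ac *;
    first [by rewrite -[RHS]cyc0; ring
          |by rewrite -[RHS]oppr0 -cyc0 (omegaN x y) (omegaN y z) (omegaN z x);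
           ring].
have {}gE a b : a != b -> [set a; b] \in L ->
    omega a b = gamma [set b] - gamma [set a].
  move=> neq_ab abL; case: (ltngtP a b) => [ltab|ltba|/val_inj eqab].
  - by rewrite -coboundary_set2 // -gE ?cochain2E // cards2 neq_ab.
  - rewrite omegaN -opprB -coboundary_set2 //; rewrite setUC in abL.
    by rewrite -gE ?cochain2E // cards2 eq_sym neq_ab.
  - by rewrite eqab eqxx in neq_ab.
case/eqP: nz; rewrite !gE //; ring.
Qed.

End Cohomology.

(** * Secant complexes of forests *)

Section SecantComplexes.
Variable n : nat.
Implicit Types (D : {set {set 'I_n}}) (A C F : {set 'I_n}).

Lemma secantP q D A :
  reflect (exists2 f : {ffun 'I_q -> {set 'I_n}},
             forall i, f i \in D & A = \bigcup_i f i)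
          (A \in secant_complex q D).
Proof.
rewrite inE; apply: (iffP existsP) => [[f /andP [/forallP fD /eqP AE]]|[f fD AE]].
  by exists f.
by exists f; apply/andP; split; [apply/forallP|apply/eqP].
Qed.

Lemma secant0 D A : (A \in secant_complex 0 D) = (A == set0).
Proof.
apply/secantP/eqP => [[f _ ->]|->]; first by rewrite big_ord0.
by exists [ffun=> set0] => [[]|]; rewrite ?big_ord0.
Qed.

Lemma secant_down q D : simplicial_complex D -> down_closed (secant_complex q D).
Proof. by move=> /(secant_complex_simplicial q) []. Qed.

(** Any element of a face may be put in the first of the covering faces. *)
Lemma secant_at q D A a : simplicial_complex D ->
  A \in secant_complex q.+1 D -> a \in A ->
  exists C, [/\ C \in D, a \in C, C \subset A & A :\: C \in secant_complex q D].
Proof.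
move=> [_ downD] /secantP [f fD AE]; rewrite AE => /bigcupP [i _ ai].
exists (f i); split=> //; first exact: bigcup_sup.
apply/secantP; exists [ffun j => f (fintype.lift i j) :\: f i] => [j|].
  by rewrite ffunE; apply: downD (fD (fintype.lift i j)) _; apply: subsetDl.
apply/setP=> x; apply/setDP/bigcupP => [[/bigcupP [j _ xj] xi]|[j _]].
  case: (unliftP i j) xj => [j' ->|->] xj; last by rewrite xj in xi.
  by exists j' => //; rewrite ffunE inE xi.
rewrite ffunE => /setDP [xj xi]; split=> //.
by apply/bigcupP; exists (fintype.lift i j).
Qed.

Lemma secant_add q D A C : simplicial_complex D -> C \in D ->
  A :\: C \in secant_complex q D -> A \in secant_complex q.+1 D.
Proof.
move=> [_ downD] CD /secantP [f fD AE]; apply/secantP.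
exists [ffun j => if unlift ord0 j is Some j' then f j' else A :&: C] => [j|].
  rewrite ffunE; case: unliftP => [j' _|_]; first exact: fD.
  by apply: downD CD _; apply: subsetIr.
rewrite big_ord_recl ffunE unlift_none -{1}(setID A C) AE; congr (_ :|: _).
by apply: eq_bigr => j _; rewrite ffunE liftK.
Qed.

Lemma secantS q D A : simplicial_complex D ->
  A \in secant_complex q D -> A \in secant_complex q.+1 D.
Proof.
by move=> scD Aq; have [D0 _] := scD; apply: secant_add D0 _; rewrite ?setD0.
Qed.

Lemma secant1 D A : simplicial_complex D -> A \in secant_complex 1 D -> A \in D.
Proof.
move=> [D0 downD]; case: (set_0Vmem A) => [->//|[a aA]] /secant_at.
move=> /(_ a (conj D0 downD) aA) [C [CD _ _]]; rewrite secant0 setD_eq0.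
exact: downD.
Qed.

Definition induced q D (U : {set 'I_n}) : {set {set 'I_n}} :=
  [set A in secant_complex q D | A \subset U].

Lemma in_induced q D U A :
  (A \in induced q D U) = (A \in secant_complex q D) && (A \subset U).
Proof. by rewrite /induced in_set. Qed.

Lemma in_link D F A : (A \in link D F) = [disjoint A & F] && (A :|: F \in D).
Proof. by rewrite /link in_set. Qed.

End SecantComplexes.

Section ForestObstructions.
Variables (k : fieldType) (n : nat) (e : rel 'I_n).
Hypothesis forest_e : forest e.
Implicit Types (A B C F U X : {set 'I_n}) (a b u v x y z : 'I_n).
Local Notation Delta := (clique_complex e).

Lemma edgeC x y : e x y = e y x.
Proof. by case: forest_e => [[sym_e _] _]; apply: sym_e. Qed.

Lemma edge_neq x y : e x y -> x != y.
Proof.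
case: forest_e => [[_ irr_e] _] exy; apply: contraTneq exy => ->.
by rewrite irr_e.
Qed.

Lemma cliqueP C :
  reflect (forall x y, x \in C -> y \in C -> x != y -> e x y) (C \in Delta).
Proof.
rewrite inE; apply: (iffP forall_inP) => [cl x y xC yC|cl x xC].
  by move/forall_inP: (cl x xC) => /(_ y yC) /implyP.
by apply/forall_inP=> y yC; apply/implyP; apply: cl.
Qed.

Lemma clique1 x : [set x] \in Delta.
Proof. by apply/cliqueP=> y z /set1P-> /set1P->; rewrite eqxx. Qed.

Lemma clique2 x y : e x y -> [set x; y] \in Delta.
Proof.
move=> exy; apply/cliqueP=> a b /set2P [] -> /set2P [] ->; rewrite ?eqxx //.
by rewrite edgeC.
Qed.

Lemma cliques_simplicial : simplicial_complex Delta.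
Proof. exact: clique_complex_simplicial. Qed.
Local Notation scD := cliques_simplicial.

(** Any other chord would close a cycle. *)
Lemma path_chord x y s :
  path e x s -> uniq (x :: s) -> e x y -> y \in s -> y = head x s.
Proof.
case: forest_e => _ acyc + + exy ys; case/splitPr: ys => s1 s2.
case: s1 => [|z s1] //; rewrite -cat_rcons cat_path => /andP [ps1 _] us.
have cyc : cycle e (x :: rcons (z :: s1) y).
  by rewrite /cycle rcons_path ps1 last_rcons edgeC.
have /acyc - /(_ cyc) : uniq (x :: rcons (z :: s1) y).
  by move: us; rewrite -cat_cons cat_uniq => /andP [].
by rewrite /= size_rcons.
Qed.

Lemma clique_le2 C : C \in Delta -> (#|C| <= 2)%N.
Proof.
move/cliqueP=> cl; rewrite leqNgt; apply/negP=> /card_gt2P.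
case=> x [y [z [[xC yC zC] [neq_xy neq_yz neq_zx]]]].
have exy := cl x y xC yC neq_xy; have eyz := cl y z yC zC neq_yz.
have ezx := cl z x zC xC neq_zx.
have /= zy : z = head x [:: y; z].
  apply: path_chord; rewrite /= ?exy ?eyz ?inE ?eqxx ?orbT //;
    last by rewrite edgeC.
  by rewrite !negb_or neq_xy neq_yz eq_sym neq_zx.
by rewrite zy eqxx in neq_yz.
Qed.

Lemma card_secant q A : A \in secant_complex q Delta -> (#|A| <= q.*2)%N.
Proof.
elim: q A => [|q IHq] A; first by rewrite secant0 => /eqP->; rewrite cards0.
have [->|[a aA]] := set_0Vmem A; first by rewrite cards0.
move=> /(secant_at scD) /(_ aA) [C [/clique_le2 cardC _ _ /IHq]].
rewrite cardsD doubleS => cardAC.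
by have := subset_leq_card (subsetIr A C); lia.
Qed.

(** The numerical condition says that the lower bound given by this link
    exceeds the number of vertices minus 2q. *)
Definition obstructed q U : Prop :=
  exists F i, [/\ F \subset U, (#|F| + i < q.*2)%N &
    cohomology_nonzero k (link (induced q Delta U) F) i].

(** A maximal face through an isolated vertex spends one clique on it, and is
    therefore a facet with fewer than 2q elements. *)
Lemma obstructed_isolated q U a :
  a \in U -> (forall u, u \in U -> ~~ e a u) -> obstructed q.+1 U.
Proof.
move=> aU isol.
have a_in : ([set a] \in induced q.+1 Delta U) && (a \in [set a]).
  rewrite set11 andbT in_induced sub1set aU andbT.
  apply: (secant_add scD (clique1 a)); rewrite setDv.
  by elim: q => [|q IHq]; [rewrite secant0|apply: secantS scD IHq].
have [F /andP [FU aF] maxF] := @arg_maxnP _ [set a]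
  (fun F => (F \in induced q.+1 Delta U) && (a \in F)) (fun F => #|F|) a_in.
have /[!in_induced] /andP [Fsec subF] := FU.
exists F, 0%N; split=> //.
  have [C [Ccl aC subC /card_secant]] := secant_at scD Fsec aF.
  have -> : C = [set a].
    apply/setP=> x; rewrite inE; apply/idP/eqP => [xC|->//]; apply/eqP.
    apply: contraNT (isol x _); last exact/(subsetP subF)/(subsetP subC).
    by move=> neq_xa; apply: (cliqueP _ Ccl) => //; rewrite eq_sym.
  by rewrite (cardsD1 a F) aF doubleS addn0 add1n !ltnS.
apply: cohomology_facet => [|A].
  by rewrite in_link set0U FU -setI_eq0 set0I eqxx.
rewrite in_link => /andP [disjAF AFU].
have := maxF (A :|: F); rewrite AFU inE aF orbT => /(_ isT).
rewrite cardsU (eqP (_ : A :&: F == set0)) ?setI_eq0 // cards0 => cardA.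
by apply/eqP; rewrite -cards_eq0; lia.
Qed.

(** A pendant vertex is best covered together with its neighbour. *)
Lemma secant_leaf q U A a v : A \subset U -> e a v ->
  (forall u, u \in U -> e a u -> u = v) ->
  (A :|: [set a; v] \in secant_complex q.+1 Delta) =
  (A :\: [set a; v] \in secant_complex q Delta).
Proof.
move=> subA eav leaf; apply/idP/idP => [Aq|Aq].
  have [|C [Ccl aC subC ACq]] := secant_at (a := a) scD Aq.
    by rewrite !inE eqxx orbT.
  apply: (secant_down scD ACq).
  apply/subsetP=> x; rewrite !inE negb_or => /andP [/andP [neq_xa neq_xv] xA].
  rewrite xA andbT; apply: contra neq_xv => xC; apply/eqP/leaf.
    exact: (subsetP subA).
  by apply: (cliqueP _ Ccl) => //; rewrite eq_sym.
by apply: (secant_add scD (clique2 eav)); rewrite setDUl setDv setU0.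
Qed.

(** The link of a leaf edge in the complex for q + 1 is the complex for q on
    the other vertices. *)
Lemma obstructed_leaf q U a v : a \in U -> v \in U -> e a v ->
  (forall u, u \in U -> e a u -> u = v) ->
  obstructed q (U :\: [set a; v]) -> obstructed q.+1 U.
Proof.
move=> aU vU eav leaf [F [i [subF ltFi nz]]].
have subav : [set a; v] \subset U by rewrite subUset !sub1set aU.
move: subF; rewrite subsetD => /andP [subF disjF].
exists (F :|: [set a; v]), i; split; first by rewrite subUset subF.
  by rewrite cardsU (disjoint_setI0 disjF) cards0 cards2 edge_neq // doubleS; lia.
suff -> : link (induced q.+1 Delta U) (F :|: [set a; v]) =
          link (induced q Delta (U :\: [set a; v])) F by [].
have leafE A (subA : A \subset U) := secant_leaf q subA eav leaf.
move: [set a; v] subav disjF leafE => E subE disjF leafE.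
apply/setP=> A; rewrite !in_link !in_induced setUA.
rewrite subsetD -!setI_eq0 setIUr setIUl !setU_eq0 (disjoint_setI0 disjF).
rewrite eqxx andbT.
rewrite (subUset U (A :|: F)) subE andbT.
case: eqP => //= _; have [disjA|_] := boolP (_ == _); rewrite /= ?andbF //.
have [subAF|_] := boolP (A :|: F \subset U); rewrite ?andbF //= !andbT.
rewrite leafE // (_ : (A :|: F) :\: E = A :|: F) //; apply/setDidPl.
by rewrite -setI_eq0 setIUl (eqP disjA) (disjoint_setI0 disjF) setU0.
Qed.

Lemma obstructed_disconnected1 U X x y :
  X \subset U -> x \in X -> y \in U :\: X ->
  (forall a b, a \in X -> b \in U :\: X -> ~~ e a b) -> obstructed 1 U.
Proof.
move=> subX xX /setDP [yU yX] sep; exists set0, 1%N.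
rewrite sub0set cards0; split=> //.
have faceE A : (A \in link (induced 1 Delta U) set0) =
    (A \in secant_complex 1 Delta) && (A \subset U).
  by rewrite in_link in_induced setU0 -setI_eq0 setI0 eqxx.
have vertex z : z \in U -> [set z] \in link (induced 1 Delta U) set0.
  move=> zU; rewrite faceE sub1set zU andbT.
  by apply: (secant_add scD (clique1 z)); rewrite setDv secant0.
apply: (@cohomology_disconnected _ _ _ X x y) => //.
- by apply: vertex; apply: (subsetP subX).
- exact: vertex.
move=> a b; rewrite faceE => /andP [/(secant1 scD)/cliqueP cl].
rewrite subUset !sub1set => /andP [aU bU].
have [->//|neq_ab] := eqVneq a b.
have eab : e a b by apply: cl; rewrite ?set21 ?set22.
case: (boolP (a \in X)) (boolP (b \in X)) => aX [] bX //.
  by have := sep a b aX; rewrite inE bX bU eab => /(_ isT).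
by have := sep b a bX; rewrite inE aX aU edgeC eab => /(_ isT).
Qed.

Definition avoiding v : rel 'I_n := fun x y => [&& e x y, x != v & y != v].

(** Otherwise a path outside v between the neighbours would close a cycle
    through v. *)
Lemma neighbours_separated v x y :
  e v x -> e v y -> connect (avoiding v) x y -> x = y.
Proof.
move=> evx evy /connectP [p0 pp0 yE]; move: pp0 yE.
case/shortenP=> p pp up _ yE.
case: p pp up yE => [|z p] pp up yE //; exfalso.
have vp : v \notin x :: z :: p.
  rewrite inE negb_or (edge_neq evx) /=.
  elim: (z :: p) x pp {evx up yE} => //= a s IHs x /andP [/and3P [_ _ av] ps].
  by rewrite inE eq_sym negb_or av (IHs a).
have pe : path e v (x :: z :: p).
  rewrite /= evx; apply: sub_path pp => a b; by case/and3P.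
have := @path_chord v y (x :: z :: p) pe; rewrite cons_uniq vp up => /(_ isT evy).
rewrite {1}yE mem_last => /(_ isT) /= yx.
have : y \in z :: p by rewrite yE /= mem_last.
by move: up; rewrite cons_uniq -yx => /andP [/negbTE->].
Qed.

(** The link of a vertex v with three neighbours x1, x2, x3 carries the
    nontrivial loop x1 x2 x3: the cochain omega below is 1 on it. A triangle
    of the link consists of a neighbour x of v and an edge outside v, whose
    ends lie in the same branch at v. *)
Lemma obstructed_branch U v x1 x2 x3 :
  v \in U -> x1 \in U -> x2 \in U -> x3 \in U ->
  e v x1 -> e v x2 -> e v x3 -> x1 != x2 -> x2 != x3 -> x3 != x1 ->
  obstructed 2 U.
Proof.
move=> vU x1U x2U x3U ev1 ev2 ev3 x12 x23 x31.
exists [set v], 2%N; rewrite sub1set cards1; split=> //.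
pose br x y := connect (avoiding v) x y.
have br_nbr x y : e v x -> e v y -> br x y = (y == x).
  move=> evx evy; apply/idP/eqP => [/neighbours_separated ->//|->].
  exact: connect0.
have br_edge x y z : e y z -> y != v -> z != v -> br x y = br x z.
  move=> eyz yv zv; have sub y' z' : e y' z' -> y' != v -> z' != v ->
      br x y' -> br x z'.
    move=> eyz' yv' zv' /connect_trans; apply; apply: connect1.
    by rewrite /avoiding eyz' yv'.
  by apply/idP/idP; apply: sub; rewrite // edgeC.
(* omega x1 y = 1 for y in the branch of x2, and omega y x2 = 1 for y in the
   branch of x1; these two rules agree on omega x1 x2 *)
pose P x y := (x == x1) && br x2 y || (y == x2) && br x1 x.
pose omega x y : k := (P x y)%:R - (P y x)%:R.
have P_edge x y : e x y -> x != v -> y != v -> P x y = false.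
  move=> exy xv yv; apply/norP; split; apply/negP => /andP [/eqP E].
    by rewrite -(br_edge _ x y) // E br_nbr // (negbTE x12).
  by rewrite (br_edge _ x y) // E br_nbr // eq_sym (negbTE x12).
have P_nbrl x y : e v x -> P x y = (x == x1) && br x2 y.
  move=> evx; apply/orb_idr => /andP [/eqP-> ].
  by rewrite !br_nbr // eqxx andbT.
have P_nbrr x y : e v x -> P y x = (x == x2) && br x1 y.
  move=> evx; apply/orb_idl => /andP [/eqP->].
  by rewrite !br_nbr // eqxx andbT.
have omega_nbr x y z : e v x -> e y z -> y != v -> z != v ->
    omega x y = omega x z.
  move=> evx eyz yv zv.
  by rewrite /omega !(P_nbrl x) // !(P_nbrr x) // !(br_edge _ y z).
have omegaN x y : omega y x = - omega x y by rewrite opprB.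
have nbr_neq x : e v x -> x != v by move/edge_neq; rewrite eq_sym.
have pair_link x y : x \in U -> y \in U -> e v x -> e v y ->
    [set x; y] \in link (induced 2 Delta U) [set v].
  move=> xU yU evx evy; rewrite in_link in_induced.
  rewrite disjoint_sym disjoints1 in_set2 !(eq_sym v) !(negbTE (nbr_neq _ _)) //=.
  rewrite !subUset !sub1set xU yU vU !andbT.
  apply: (secant_add scD (clique2 evx)); apply: (secant_add scD (clique1 y)).
  rewrite secant0; apply/eqP/setP=> z; rewrite !inE.
  by case: (z == x); case: (z == y); case: (z == v).
apply: (@cohomology_cochain2 _ _ _ omega x1 x2 x3) => //; try exact: pair_link.
  move=> B; rewrite in_link in_induced => /and3P [disjBv Bsec BU] cardB.
  have vB : v \notin B by rewrite disjoint_sym disjoints1 in disjBv.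
  have [|C [Ccl vC subC Rsec]] := secant_at (a := v) scD Bsec.
    by rewrite !inE eqxx orbT.
  move: Rsec => /(secant1 scD); set R := _ :\: C => Rcl.
  have cardBv : #|B :|: [set v]| = 4.
    by rewrite setUC cardsU1 vB cardB.
  have cardR : #|R| = (4 - #|C|)%N by rewrite cardsDS // cardBv.
  have := clique_le2 Ccl; have := clique_le2 Rcl; rewrite cardR => leR leC.
  have C2 : #|C| = 2 by move: leR leC; case: #|C| => [|[|[|]]].
  have /eqP/cards1P [x CvE] : #|C :\ v| = 1%N.
    by move: C2; rewrite (cardsD1 v) vC => -[].
  have /eqP/cards2P [y [z [yz RE]]] : #|R| = 2 by rewrite cardR C2.
  have BE : B = [set x; y; z].
    have -> : B = (C :\ v) :|: R.
      apply/setP=> w; rewrite !inE; have := subsetP subC w; rewrite !inE.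
      case: eqP => [->|_]; rewrite ?(negbTE vB) ?vC //=.
      by rewrite !orbF; case: (w \in C) => // /(_ isT) ->.
    by rewrite CvE RE setUA.
  have evx : e v x.
    have : x \in C :\ v by rewrite CvE set11.
    by rewrite in_setD1 => /andP [xv xC]; apply: (cliqueP _ Ccl); rewrite 1?eq_sym.
  have eyz : e y z by apply: (cliqueP _ Rcl); rewrite // RE ?set21 ?set22.
  have yv : y != v by apply: contraNneq vB => <-; rewrite BE !inE eqxx orbT.
  have zv : z != v by apply: contraNneq vB => <-; rewrite BE !inE eqxx !orbT.
  exists x, y, z; split=> //.
  rewrite (omegaN x z) (omega_nbr x y z) //.
  by rewrite /omega (P_edge y z) // (P_edge z y) 1?edgeC // subrr addr0 subrr.
have x13 : x1 != x3 by rewrite eq_sym.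
rewrite /omega !P_nbrl // !br_nbr // !eqxx.
rewrite !(negbTE x12, negbTE x23, negbTE x31, negbTE x13).
rewrite !(eq_sym x2 x1, eq_sym x3 x2) !(negbTE x12, negbTE x23).
by rewrite ?andbF /= !subr0 !addr0 oner_eq0.
Qed.

Definition path_in X s : Prop := [/\ sorted e s, uniq s & {subset s <= X}].

Definition traceable U : Prop := exists2 s, path_in U s & s =i U.

Lemma sorted_edge s1 x y s2 : sorted e (s1 ++ x :: y :: s2) -> e x y.
Proof.
by case: s1 => [|z t] /=; rewrite ?cat_path /= => /andP [] // _ /and3P [].
Qed.

Lemma sorted_rev_edge s : sorted e (rev s) = sorted e s.
Proof. by rewrite rev_sorted; apply: eq_sorted => x y; apply: edgeC. Qed.

Lemma path_in_rev X s : path_in X s -> path_in X (rev s).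
Proof.
case=> ps us sX; split; rewrite ?sorted_rev_edge ?rev_uniq // => x.
by rewrite mem_rev; apply: sX.
Qed.

Lemma longest_path X : X != set0 ->
  exists s, [/\ path_in X s, s != [::] &
    forall t, path_in X t -> (size t <= size s)%N].
Proof.
case/set0Pn=> x xX.
pose P m := `[< exists2 s, path_in X s & size s = m >].
have exP : exists m, P m.
  exists 1%N; apply/asboolP; exists [:: x] => //; split=> // y.
  by rewrite inE => /eqP->.
have leP m : P m -> (m <= n)%N.
  move=> /asboolP [s [_ us _] <-].
  by rewrite -(card_uniqP us) -[X in (_ <= X)%N]card_ord max_card.
have [m /asboolP [s ps <-] maxm] := ex_maxnP exP leP.
exists s; split=> // [|t pt]; last by apply: maxm; apply/asboolP; exists t.
have /maxm : P 1%N.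
  apply/asboolP; exists [:: x] => //; split=> // y.
  by rewrite inE => /eqP->.
by case: s {ps maxm}.
Qed.

Lemma path_in_cons X x s : path_in X s -> x \in X -> x \notin s -> e x (head x s) ->
  path_in X (x :: s).
Proof.
case=> ps us sX xX xs exs; split=> [||y]; rewrite /= ?xs //.
  by case: s ps exs {us sX xs} => //= y s ps ->.
by rewrite inE => /predU1P [->|/sX].
Qed.

(** In a forest the first vertex of a longest path has no neighbour but the
    second. *)
Lemma exists_leaf X : X != set0 ->
  (forall x, x \in X -> exists2 y, y \in X & e x y) ->
  exists a v, [/\ a \in X, v \in X, e a v & forall u, u \in X -> e a u -> u = v].
Proof.
move=> /longest_path [s [pin s_nil maxs]] nbr.
case: s => [//|a s] in pin s_nil maxs *; have [ps us sX] := pin.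
have aX : a \in X by apply: sX; rewrite mem_head.
have nbr_s u : u \in X -> e a u -> u \in s.
  move=> uX eau; apply/negPn/negP => us'.
  have /maxs : path_in X (u :: a :: s).
    apply: path_in_cons => //; rewrite /= 1?edgeC //.
    by rewrite inE negb_or us' andbT eq_sym edge_neq.
  by rewrite /= ltnn.
have [v0 v0X eav0] := nbr a aX.
case: s => [|v s] in pin s_nil ps us sX maxs nbr_s *.
  by have := nbr_s _ v0X eav0.
exists a, v; split=> // [||u uX eau].
- by apply: sX; rewrite !inE eqxx orbT.
- by case/andP: ps.
- exact: (path_chord ps us eau (nbr_s u uX eau)).
Qed.

Lemma traceable_degree U z x1 x2 x3 : traceable U ->
  z \in U -> x1 \in U -> x2 \in U -> x3 \in U ->
  e z x1 -> e z x2 -> e z x3 -> x1 != x2 -> x2 != x3 -> x3 != x1 -> False.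
Proof.
case=> s [ps us _] sU; rewrite -!sU => zs; case/splitPr: zs ps us => s1 s2 ps us.
have nbr x : x \in s1 ++ z :: s2 -> e z x ->
    x = head z (rev s1) \/ x = head z s2.
  rewrite mem_cat inE orbCA => /or3P [/eqP xz|xs1|xs2] ezx.
  - by have := edge_neq ezx; rewrite xz eqxx.
  - left; apply: path_chord; rewrite ?mem_rev //.
      move: ps; rewrite -sorted_rev_edge rev_cat rev_cons cat_rcons.
      by case: (rev s2) => [|y t] //=; rewrite cat_path => /andP [_ /= /andP []].
    move: us; rewrite -rev_uniq rev_cat rev_cons cat_rcons cat_uniq.
    by case/and3P.
  - right; apply: path_chord => //.
      by case: s1 ps {us} => [|y t] //=; rewrite cat_path => /andP [_ /= /andP []].
    by move: us; rewrite cat_uniq => /and3P [].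
move=> h1 h2 h3 e1 e2 e3.
by case: (nbr _ h1 e1) (nbr _ h2 e2) (nbr _ h3 e3) => -> [] -> [] ->; rewrite eqxx.
Qed.

Definition connected U : Prop := forall X,
  X \subset U -> X != set0 -> U :\: X != set0 ->
  exists x y, [/\ x \in X, y \in U :\: X & e x y].

(** A longest path cannot be extended at its ends, so an edge that leaves it
    starts at an inner vertex, which then has three neighbours. *)
Lemma traceable_of_degree U : U != set0 -> connected U ->
  (forall z x1 x2 x3, z \in U -> x1 \in U -> x2 \in U -> x3 \in U ->
     e z x1 -> e z x2 -> e z x3 -> x1 != x2 -> x2 != x3 -> x3 != x1 -> False) ->
  traceable U.
Proof.
move=> /longest_path [s [[ps us sU] s_nil maxs]] connU degU.
pose X := [set x in s].
have XU : X \subset U by apply/subsetP=> x; rewrite inE; apply: sU.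
have [UX|UX] := eqVneq (U :\: X) set0.
  exists s => // x; apply/idP/idP => [/sU//|xU].
  have : x \notin U :\: X by rewrite UX inE.
  by rewrite !inE xU andbT negbK.
have [x [y [xX /setDP [yU]]]] : exists x y, [/\ x \in X, y \in U :\: X & e x y].
  apply: connU => //; apply/set0Pn.
  case: s s_nil {ps us sU maxs UX XU} @X => // a s _.
  by exists a; rewrite inE mem_head.
move: xX; rewrite !inE => xs ys exy.
have pin : path_in U s by [].
case/splitPr: xs ps us sU s_nil maxs {X XU UX} ys pin => s1 s2.
move=> ps us sU _ maxs ys pin.
have too_long t : path_in U (y :: t) -> size t = size (s1 ++ x :: s2) -> False.
  by move/maxs=> /= + E; rewrite E ltnn.
case/lastP: s1 => [|s1 w] in ps us sU maxs ys pin too_long *.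
  by case: (too_long (x :: s2)) => //; apply: path_in_cons; rewrite //= edgeC.
case: s2 => [|z s2] in ps us sU maxs ys pin too_long *.
  case: (too_long (rev (rcons s1 w ++ [:: x]))); last by rewrite size_rev.
  apply: path_in_cons; rewrite ?mem_rev //; first exact: path_in_rev.
  by rewrite rev_cat /= edgeC.
exfalso; apply: (degU x w z y) => //;
  try by apply: sU; rewrite !(mem_cat, mem_rcons, inE) eqxx ?orbT.
- by rewrite edgeC; apply: (@sorted_edge s1 _ _ (z :: s2)); rewrite -cat_rcons.
- exact: sorted_edge ps.
- move: us; rewrite cat_uniq => /and3P [_ /hasPn /(_ z) + _].
  rewrite !inE eqxx orbT => /(_ isT); rewrite mem_rcons inE negb_or.
  by case/andP; rewrite eq_sym.
- by apply: contraNneq ys => <-; rewrite mem_cat !inE eqxx !orbT.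
- by apply: contraNneq ys => ->; rewrite mem_cat mem_rcons inE eqxx.
Qed.

Lemma isolatedVneighbours U :
  (exists2 a, a \in U & forall u, u \in U -> ~~ e a u) \/
  (forall x, x \in U -> exists2 y, y \in U & e x y).
Proof.
have [/exists_inP [a aU /forall_inP isol]|nbr] :=
  boolP [exists a in U, forall u in U, ~~ e a u].
  by left; exists a.
right=> x xU; move: nbr; rewrite negb_exists_in => /forall_inP /(_ x xU).
by rewrite negb_forall_in => /exists_inP [y yU]; rewrite negbK; exists y.
Qed.

Lemma card_setD_edge U a v : a \in U -> v \in U -> e a v ->
  #|U| = #|U :\: [set a; v]|.+2.
Proof.
move=> aU vU eav; rewrite -(cardsID [set a; v] U) (setIidPr _).
  by rewrite cards2 edge_neq.
by rewrite subUset !sub1set aU.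
Qed.

(** Removing leaf edges from the larger side of a separation reduces to a
    disconnected graph with [q = 1]. *)
Lemma obstructed_separated q U X :
  (q.+1.*2 + 2 <= #|U|)%N -> X \subset U -> X != set0 -> U :\: X != set0 ->
  (forall a b, a \in X -> b \in U :\: X -> ~~ e a b) -> obstructed q.+1 U.
Proof.
elim: q U X => [|q IHq] U X leU subX.
  by move=> /set0Pn [x xX] /set0Pn [y yUX]; apply: obstructed_disconnected1 xX yUX.
have [[a aU isol]|nbr] := isolatedVneighbours U.
  by move=> *; apply: obstructed_isolated isol.
wlog ltX : X subX / (2 < #|X|)%N => [wlogX X0 Y0 sep|X0 Y0 sep].
  have [|leX] := ltnP 2 #|X|; first by move/wlogX; apply.
  have UUX : U :\: (U :\: X) = X.
    by rewrite setDDr setDv set0U; apply/setIidPr.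
  apply: (wlogX (U :\: X)); rewrite ?UUX ?subsetDl //.
    have := leq_trans leU (leqnn _); rewrite -(cardsID X U) (setIidPr subX).
    by move: leX; move: #|X| #|_ :\: X| => c d; rewrite !doubleS; lia.
  by move=> a b aU bX; rewrite edgeC; apply: sep.
have [|a [v [aX vX eav leaf]]] := exists_leaf X0.
  move=> x xX; have [y yU exy] := nbr x (subsetP subX x xX).
  exists y => //; apply: contraLR exy => yX; apply: sep => //.
  by rewrite inE yX.
have leafU u : u \in U -> e a u -> u = v.
  move=> uU eau; apply: leaf => //; apply: contraLR eau => uX.
  by apply: sep; rewrite // inE uX.
have [aU vU] := (subsetP subX a aX, subsetP subX v vX).
apply: (obstructed_leaf aU vU eav leafU).
have DE : U :\: [set a; v] :\: (X :\: [set a; v]) = U :\: X.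
  apply/setP=> x; rewrite !inE; case: (boolP ((x == a) || (x == v))) => [xav|_] //=.
  by have -> : x \in X by case/orP: xav => /eqP->.
apply: (IHq _ (X :\: [set a; v])); rewrite ?DE ?setSD //.
- by move: leU; rewrite (card_setD_edge aU vU eav) doubleS.
- by rewrite -card_gt0; move: ltX; rewrite (card_setD_edge aX vX eav).
- by move=> x y /setDP [xX _]; apply: sep.
Qed.

Lemma connected_of_not_obstructed q U :
  (q.+1.*2 + 2 <= #|U|)%N -> ~ obstructed q.+1 U -> connected U.
Proof.
move=> leU nob X subX X0 Y0.
have [/exists_inP [x xX /exists_inP [y yY exy]]|noe] :=
  boolP [exists x in X, exists y in U :\: X, e x y]; first by exists x, y.
case: nob; apply: (obstructed_separated leU subX) => // a b aX bY.
apply: contraNN noe => eab; apply/exists_inP; exists a => //.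
by apply/exists_inP; exists b.
Qed.

(** Once a leaf edge a v has been removed, what remains is a path by
    induction. If v were attached to an inner vertex y of it, removing the
    last edge of the longer of the two arms would again leave a path, in
    which y has three neighbours. *)
Lemma traceable_of_not_obstructed q U :
  (q.+2.*2 + 2 <= #|U|)%N -> ~ obstructed q.+2 U -> traceable U.
Proof.
elim: q U => [|q IHq] U leU nob.
  apply: traceable_of_degree; first by rewrite -card_gt0; apply: leq_trans leU.
    exact: connected_of_not_obstructed leU nob.
  move=> z x1 x2 x3 zU x1U x2U x3U e1 e2 e3 n12 n23 n31; apply: nob.
  exact: (obstructed_branch zU x1U x2U x3U).
have U0 : U != set0 by rewrite -card_gt0; apply: leq_trans leU.
have peel a v : a \in U -> v \in U -> e a v ->
    (forall u, u \in U -> e a u -> u = v) -> traceable (U :\: [set a; v]).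
  move=> aU vU eav leaf; apply: IHq.
    by move: leU; rewrite (card_setD_edge aU vU eav) doubleS.
  by move=> ob; apply: nob; apply: (obstructed_leaf aU vU eav leaf).
have [[a aU isol]|nbr] := isolatedVneighbours U.
  by case: nob; apply: obstructed_isolated isol.
have [a [v [aU vU eav leaf]]] := exists_leaf U0 nbr.
have [s [ps us _] sE] := peel a v aU vU eav leaf.
have [x0 [y [/set2P xE]]] : exists x y,
    [/\ x \in [set a; v], y \in U :\: [set a; v] & e x y].
  apply: (connected_of_not_obstructed leU nob).
  - by rewrite subUset !sub1set aU.
  - by apply/set0Pn; exists a; rewrite set21.
  - rewrite -card_gt0; move: leU; rewrite (card_setD_edge aU vU eav) !doubleS.
    by case: #|_|.
move=> yU' exy; have /setDP [yU] := yU'; rewrite in_set2 => /norP [neq_ya neq_yv].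
have {exy xE} evy : e v y.
  case: xE exy => -> // eay; by rewrite (leaf y yU eay) eqxx in neq_yv.
have cards : (5 < size s)%N.
  rewrite -(card_uniqP us) (eq_card sE); move: leU.
  by rewrite (card_setD_edge aU vU eav) !doubleS; move: #|_| => c; lia.
have ys : y \in s by rewrite sE.
case/splitPr: ys ps us sE cards => s1 s2 ps us sE cards.
wlog le12 : s1 s2 ps us sE cards / (size s1 <= size s2)%N.
  move=> wlogs; have [|/ltnW le21] := leqP (size s1) (size s2); first exact: wlogs.
  have revE : rev s2 ++ y :: rev s1 = rev (s1 ++ y :: s2).
    by rewrite rev_cat rev_cons cat_rcons.
  apply: (wlogs (rev s2) (rev s1)); rewrite ?revE ?size_rev //.
  - by rewrite sorted_rev_edge.
  - by rewrite rev_uniq.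
  - by move=> u; rewrite mem_rev.
have avs x : (x \in s1 ++ y :: s2) = (x \in U) && (x != a) && (x != v).
  by rewrite sE in_setD in_set2 negb_or andbC andbA.
have in_U x : x \in s1 ++ y :: s2 -> x \in U by rewrite avs => /andP [/andP []].
case/lastP: s1 => [|s1 w] in ps us sE cards le12 avs in_U *.
  have UE : a :: v :: y :: s2 =i U.
    move=> x; rewrite 2!inE avs; case: eqVneq => [->|_] /=; first by rewrite aU.
    by case: eqVneq => [->|_] /=; rewrite ?vU ?andbT ?orbF.
  exists (a :: v :: y :: s2) => //; split=> [||x]; last by rewrite UE.
    by rewrite /= eav evy.
  have [as2 vs2] : a \notin y :: s2 /\ v \notin y :: s2.
    by rewrite !avs !eqxx !andbF.
  by rewrite 2!cons_uniq us vs2 in_cons negb_or as2 edge_neq.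
exfalso.
(* the path has at least six vertices besides a and v *)
have {cards le12} : (2 < size s2)%N.
  by move: cards le12; rewrite size_cat size_rcons /=; lia.
case: (lastP s2) => [//|t b] in ps us sE avs in_U *.
case: (lastP t) => [|{}t b2] in ps us sE avs in_U *; first by rewrite size_rcons.
case: t => [|z t] in ps us sE avs in_U *; first by rewrite !size_rcons.
move=> _.
pose r := rcons s1 w ++ y :: z :: t.
have sr : rcons s1 w ++ y :: rcons (rcons (z :: t) b2) b = rcons (rcons r b2) b.
  by rewrite -!rcons_cons -!rcons_cat.
rewrite sr in ps us sE avs in_U.
have [ebb2 ub] : e b b2 /\ uniq [:: b, b2 & rev r].
  move: ps us; rewrite -sorted_rev_edge -rev_uniq !rev_rcons => /= /andP [-> _].
  by [].
have psb : path e b (b2 :: rev r).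
  by move: ps; rewrite -sorted_rev_edge !rev_rcons.
have bs : b \in rcons (rcons r b2) b by rewrite mem_rcons mem_head.
have b2s : b2 \in rcons (rcons r b2) b by rewrite !(mem_rcons, inE) eqxx orbT.
have rs x : x \in r -> x \in rcons (rcons r b2) b.
  by move=> xr; rewrite !(mem_rcons, in_cons) xr !orbT.
have yr : y \in r by rewrite mem_cat inE eqxx orbT.
have leafb u : u \in U -> e b u -> u = b2.
  move=> uU ebu; have [uE|neq_ua] := eqVneq u a.
    have bv : b = v by apply: leaf (in_U b bs) _; rewrite -uE edgeC.
    by move: bs; rewrite avs bv eqxx andbF.
  have [uE|neq_uv] := eqVneq u v; last first.
    apply: (path_chord psb ub ebu).
    have : u \in rcons (rcons r b2) b by rewrite avs uU neq_ua.
    rewrite !(mem_rcons, in_cons, mem_rev).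
    move=> /or3P [/eqP ub'|->//|->]; rewrite ?orbT //.
    by have := edge_neq ebu; rewrite ub' eqxx.
  exfalso; rewrite uE edgeC in ebu => {uE}.
  have vy : b = head v (y :: rcons (rcons (z :: t) b2) b).
    apply: path_chord => //.
    - rewrite /= evy; move: ps; rewrite -sr.
      by case: (rcons s1 w) => [|c l] //=; rewrite cat_path => /andP [_ /andP []].
    - rewrite cons_uniq; apply/andP; split; last first.
        by move: us; rewrite -sr cat_uniq => /and3P [].
      apply: contraFN (_ : v \in rcons (rcons r b2) b = false) => [vs|].
        by rewrite -sr mem_cat vs orbT.
      by rewrite avs eqxx andbF.
    - by rewrite inE mem_rcons mem_head orbT.
  move: ub; rewrite vy /= inE mem_rev yr orbT.
  by [].
have tr := peel b b2 (in_U b bs) (in_U b2 b2s) ebb2 leafb.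
have U''E x : x \in r -> x \in U :\: [set b; b2].
  move=> xr; rewrite in_setD in_U ?rs // andbT in_set2; apply/norP; split;
    apply: contraTneq ub => xE; rewrite -xE /= !inE !mem_rev xr ?orbT ?andbF //.
have vU'' : v \in U :\: [set b; b2].
  rewrite in_setD vU andbT in_set2; apply/norP; split.
    by apply: contraTneq bs => vb; rewrite avs -vb eqxx andbF.
  by apply: contraTneq b2s => vb; rewrite avs -vb eqxx andbF.
have wr : w \in r by rewrite mem_cat mem_rcons mem_head.
have zr : z \in r by rewrite mem_cat !inE eqxx !orbT.
have neq_v x : x \in r -> x != v.
  by move/rs; rewrite avs => /andP [].
apply: (traceable_degree tr (U''E y yr) (U''E w wr) (U''E z zr) vU'').
- rewrite edgeC; apply: (@sorted_edge s1 _ _ (z :: rcons (rcons t b2) b)).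
  by rewrite -cat_rcons; rewrite -sr in ps.
- by rewrite -sr in ps; apply: sorted_edge ps.
- by rewrite edgeC.
- have : uniq r by move: us; rewrite !rcons_uniq => /and3P [].
  rewrite cat_uniq => /and3P [_ /hasPn /(_ z) + _].
  rewrite !inE eqxx orbT => /(_ isT); rewrite mem_rcons inE negb_or.
  by case/andP; rewrite eq_sym.
- exact: neq_v.
- by rewrite eq_sym; apply: neq_v.
Qed.

End ForestObstructions.

(** * Paths *)

Section Paths.
Variables (n : nat) (e : rel 'I_n).
Implicit Types (A B C F U X : {set 'I_n}) (x y z v : 'I_n).
Local Notation Delta := (clique_complex e).

(** By [path_chord] a Hamiltonian path of a forest is an induced path. *)
Lemma forest_traceable_path :
  forest e -> traceable e [set: 'I_n] -> is_path_graph e.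
Proof.
move=> forest_e [p [pp up _] pE].
have size_p : size p = n.
  by rewrite -(card_uniqP up) (eq_card pE) cardsT card_ord.
have nthP (i : 'I_n) : exists x, p = take i p ++ x :: drop i.+1 p /\ nth i p i = x.
  by exists (nth i p i); rewrite -drop_nth ?size_p // cat_take_drop.
have [x0|n0] := pickP 'I_n; last first.
  by exists 1%g => i; have := n0 i.
move=> _; pose f (i : 'I_n) := nth x0 p i.
have inj_f : injective f.
  by move=> i j /eqP; rewrite nth_uniq ?size_p // => /eqP/val_inj.
exists (perm inj_f) => i j; rewrite !permE.
wlog ltij : i j / (i < j)%N => [wlogij|].
  case: (ltngtP i j) => [/wlogij//|ltji|/val_inj->].
    by rewrite (edgeC forest_e) wlogij // /path_rel orbC.
  rewrite /path_rel orbb (gtn_eqF (ltnSn j)).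
  by apply/negP=> /(edge_neq forest_e); rewrite eqxx.
rewrite /path_rel [X in _ || X](gtn_eqF _) ?orbF; last exact: ltnW.
have dropE : drop i p = f i :: drop i.+1 p by rewrite -drop_nth ?size_p.
have pd : path e (f i) (drop i.+1 p).
  by have := drop_sorted i pp; rewrite dropE.
have ud : uniq (f i :: drop i.+1 p) by rewrite -dropE drop_uniq.
have lt_i1 : (i.+1 < n)%N by apply: leq_ltn_trans (ltn_ord j).
have headE : head (f i) (drop i.+1 p) = nth x0 p i.+1.
  by rewrite (drop_nth x0) ?size_p.
apply/idP/eqP => [eij|i1j].
  have : f j \in drop i.+1 p.
    have -> : f j = nth x0 (drop i.+1 p) (j - i.+1).
      by rewrite nth_drop subnKC.
    by rewrite mem_nth // size_drop size_p ltn_sub2r.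
  move/(path_chord forest_e pd ud eij)/eqP; rewrite headE nth_uniq ?size_p //.
  by move/eqP.
move: pd; rewrite (drop_nth x0) ?size_p //= => /andP [+ _].
by rewrite /f -i1j.
Qed.

Lemma codim_matching q : forest e -> has_matching_of_size e q ->
  (exists2 F, F \in secant_complex q Delta & #|F| = q.*2) /\
  codim (secant_complex q Delta) = (n - q.*2)%N.
Proof.
move=> forest_e [M [edgeM trivM] cardM].
have [F Fq cardF] : exists2 F, F \in secant_complex q Delta & #|F| = q.*2.
  exists (cover M).
    apply/secantP; exists [ffun i : 'I_q => nth set0 (enum M) i] => [i|].
      rewrite ffunE; have /edgeM [x [y [exy ->]]] : nth set0 (enum M) i \in M.
        by rewrite -mem_enum mem_nth // -cardE cardM.
      exact: clique2.
    rewrite /cover -big_enum (big_nth set0) -cardE cardM big_mkord.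
    by apply: eq_bigr => i _; rewrite ffunE.
  rewrite -(eqP trivM) -muln2 -cardM -sum_nat_const.
  apply: eq_bigr => E /edgeM [x [y [exy ->]]].
  by rewrite cards2 (edge_neq forest_e exy).
split; first by exists F.
rewrite /codim; congr (n - _)%N; apply/eqP; rewrite eqn_leq; apply/andP; split.
  by apply/bigmax_leqP=> A; apply: card_secant.
by rewrite -cardF; apply: (@leq_bigmax_cond _ _ (fun A : {set 'I_n} => #|A|)).
Qed.

Variable s : {perm 'I_n}.
Hypothesis path_s : forall i j, e (s i) (s j) = path_rel i j.

Definition initial m : {set 'I_n} := [set x | ((s^-1)%g x < m)%N].

Definition initial_secant m q : {set {set 'I_n}} :=
  [set A : {set 'I_n} | A :&: initial m \in secant_complex q Delta].

Local Notation scD := (clique_complex_simplicial e).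

Lemma initialS v m : (s^-1)%g v = m :> nat -> initial m.+1 = v |: initial m.
Proof.
move=> vm; apply/setP=> x; rewrite !inE ltnS leq_eqVlt -vm.
by congr (_ || _); apply/eqP/eqP => [/val_inj/perm_inj|->].
Qed.

Lemma in_initial_secant m q A :
  (A \in initial_secant m q) = (A :&: initial m \in secant_complex q Delta).
Proof. by rewrite /initial_secant in_set. Qed.

Lemma initial_secant_down m q : down_closed (initial_secant m q).
Proof.
move=> F F'; rewrite !in_initial_secant => Fq sF.
by apply: (secant_down scD Fq); apply: setSI.
Qed.

Lemma edge_path x y : e x y = path_rel ((s^-1)%g x) ((s^-1)%g y).
Proof. by rewrite -path_s !permKV. Qed.

Lemma initial_clique m : initial m.+2 :\: initial m \in Delta.
Proof.
rewrite inE; apply/forall_inP=> x xC; apply/forall_inP=> y yC; apply/implyP.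
rewrite edge_path /path_rel => neq_xy.
have {neq_xy} : (s^-1)%g x != (s^-1)%g y by rewrite (inj_eq perm_inj).
move: xC yC; rewrite !inE -val_eqE /=.
move: (nat_of_ord _) (nat_of_ord _) => a b; lia.
Qed.

Lemma initial_secantT m q : (m <= q.*2)%N -> initial_secant m q = setT.
Proof.
move=> lemq; suff Vmq : initial m \in secant_complex q Delta.
  apply/setP=> A; rewrite in_setT in_initial_secant.
  by apply: (secant_down scD Vmq); apply: subsetIr.
elim: q m lemq => [|q IHq] m lemq.
  rewrite secant0; apply/eqP/setP=> x; rewrite !inE.
  by move: lemq; rewrite leqn0 => /eqP->.
case: m lemq => [|[|m]] lemq.
- by apply: secantS scD _; apply: IHq.
- apply: (secant_add scD (initial_clique 0)).
  apply: (secant_down scD (IHq 0%N (leq0n _))).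
  by apply/subsetP=> x; rewrite !inE; move: (nat_of_ord _) => c; lia.
- apply: (secant_add scD (initial_clique m)).
  apply: (secant_down scD (IHq m _)); first by rewrite doubleS in lemq.
  by rewrite setDDr setDv set0U subsetIr.
Qed.

Lemma star_initial_secant m q v : (m <= (s^-1)%g v)%N ->
  star v (initial_secant m q) = initial_secant m q.
Proof.
move=> vm; apply/setP=> A; rewrite in_set !in_initial_secant setIUl.
suff -> : [set v] :&: initial m = set0 by rewrite set0U.
by apply/setP=> x; rewrite !inE; apply/negP=> /andP [/eqP->]; rewrite ltnNge vm.
Qed.

Lemma star_last_initial_secant m q v : (s^-1)%g v = m.+1 :> nat ->
  star v (initial_secant m.+2 q.+1) = initial_secant m q.
Proof.
move=> vm; apply/setP=> A; rewrite in_set !in_initial_secant.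
apply/idP/idP => [vAq|Aq].
  have [|C [Ccl vC _ Cq]] := secant_at (a := v) scD vAq.
    by rewrite !inE eqxx vm ltnSn.
  apply: (secant_down scD Cq).
  apply/subsetP=> x; rewrite !inE => /andP [xA xm].
  rewrite xA orbT (ltn_trans xm (ltnW (ltnSn m.+1))) !andbT.
  apply/negP=> xC; move: Ccl; rewrite inE => /forall_inP /(_ v vC).
  move=> /forall_inP /(_ x xC); rewrite edge_path /path_rel.
  have -> : v != x by apply: contraTneq xm => <-; rewrite vm -leqNgt; lia.
  move=> /orP []; rewrite vm; move: xm; move: (nat_of_ord _) => a; lia.
apply: (secant_add scD (initial_clique m)); apply: (secant_down scD Aq).
apply/subsetP=> x; rewrite !inE => /andP [notC /andP [xvA xm]].
move: notC; rewrite xm andbT negbK => ltxm; rewrite ltxm andbT.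
by case/orP: xvA ltxm => // /eqP->; rewrite vm ltnNge leqnSn.
Qed.

Lemma deletion_initial_secant m q v : (s^-1)%g v = m :> nat ->
  deletion v (initial_secant m.+1 q) = deletion v (initial_secant m q).
Proof.
move=> vm; apply/setP=> A; rewrite !in_set (initialS vm) setIUr.
case: (boolP (v \in A)) => vA; rewrite ?andbF //.
suff -> : A :&: [set v] = set0 by rewrite set0U.
by apply/eqP; rewrite setI_eq0 disjoint_sym disjoints1.
Qed.

Lemma deletion_initial_secant0 m v : (s^-1)%g v = m :> nat ->
  deletion v (initial_secant m 0) = initial_secant m.+1 0.
Proof.
move=> vm; apply/setP=> A; rewrite [LHS]in_set !in_initial_secant !secant0.
rewrite (initialS vm) setIUr setU_eq0 andbC; congr (_ && _).
by rewrite setI_eq0 disjoint_sym disjoints1.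
Qed.

(** Induction on the length of the path, splitting at its last vertex v: the
    star of v is the complex with two vertices and one clique less, while v is
    a cone point of the complex with one vertex less, which has the same
    deletion. *)
Lemma pd_initial_secant (k : fieldType) m q : (m <= n)%N ->
  pd_le (m - q.*2) (SR_ring k (initial_secant m q) : lmodType {mpoly k[n]}).
Proof.
elim/ltn_ind: m q => m IHm q lemn.
have last i : (i < m)%N -> exists v, (s^-1)%g v = i :> nat.
  move=> ltim; have ltin := leq_trans ltim lemn.
  by exists (s (Ordinal ltin)); rewrite permK.
have [lemq|] := leqP m q.*2.
  rewrite initial_secantT // (eqP (lemq : _ == _)); exact: pd_SR_full.
case: q => [|q] ltqm.
  case: m IHm lemn last ltqm => // m IHm lemn last _.
  have [v vm] := last m (ltnSn m).
  rewrite -(deletion_initial_secant0 vm) subn0.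
  apply: (pd_SR_deletion_cone (@initial_secant_down _ _)).
    by apply: star_initial_secant; rewrite vm.
  by have := IHm m (ltnSn m) 0%N (ltnW lemn); rewrite subn0.
case: m IHm lemn last ltqm => [|[|m]] IHm lemn last ltqm //.
have [v vm] := last m.+1 (ltnSn _).
apply: (@pd_SR_star_deletion _ _ _ _ v (@initial_secant_down _ _)).
  rewrite (star_last_initial_secant _ vm) doubleS !subSS.
  by apply: IHm; rewrite ?ltnS // ltnW // ltnW.
rewrite (deletion_initial_secant _ vm).
have -> : (m.+2 - q.+1.*2 = (m.+1 - q.+1.*2).+1)%N by rewrite subSn.
apply: (pd_SR_deletion_cone (@initial_secant_down _ _)).
  by apply: star_initial_secant; rewrite vm.
by apply: IHm; rewrite // ltnW.
Qed.

End Paths.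

Theorem theorem1p9 (k : fieldType) (q n : nat) (e : rel 'I_n) :
  (2 <= q)%N ->
  forest e ->
  (2 * q + 2 <= n)%N ->
  has_matching_of_size e q ->
  SR_cohen_macaulay k (secant_complex q (clique_complex e)) <-> is_path_graph e.
Proof.
move=> leq2q forest_e len matching_q.
have [[F Fq cardF] codimE] := codim_matching forest_e matching_q.
have leqn : (q.*2 <= n)%N by rewrite -mul2n; apply: leq_trans len; apply: leq_addr.
have downD : down_closed (secant_complex q (clique_complex e)).
  exact/secant_down/clique_complex_simplicial.
rewrite /SR_cohen_macaulay codimE; split=> [[/pd_le_resolution pdD _]|path_e].
  apply: forest_traceable_path => //.
  have [obs|nobs] := pselect (obstructed k e q [set: 'I_n]); last first.
    case: q leq2q len nobs {Fq cardF codimE matching_q leqn downD pdD}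
      => [|[|q]] // _ len nobs.
    apply: (traceable_of_not_obstructed forest_e _ nobs).
    by rewrite cardsT card_ord -mul2n.
  case: obs => G [i [_ ltGi nz]].
  have indE : induced q (clique_complex e) [set: 'I_n] =
              secant_complex q (clique_complex e).
    by apply/setP=> A; rewrite in_induced subsetT andbT.
  rewrite indE in nz; have := pd_ge_link downD nz pdD.
  by move: ltGi leqn; clear; move: #|G| => g; lia.
have [s path_s] := path_e.
split.
  apply/pd_le_resolution.
  have -> : secant_complex q (clique_complex e) = initial_secant e s n q.
    apply/setP=> A; rewrite in_initial_secant (_ : initial s n = setT) ?setIT //.
    by apply/setP=> x; rewrite !inE ltn_ord.
  exact: pd_initial_secant.
move=> d /pd_le_resolution pdd.
have link0 A : A \in link (secant_complex q (clique_complex e)) F -> A = set0.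
  rewrite in_link => /andP [/disjoint_setI0 disjAF /(card_secant forest_e)].
  rewrite cardsU disjAF cards0 cardF => cardA.
  by apply/eqP; rewrite -cards_eq0; move: cardA; move: #|A| => c; lia.
have := @pd_ge_link k n _ F 0 d downD _ pdd; rewrite addn0 cardF leq_subLR addnC.
apply; apply: cohomology_facet => //.
by rewrite in_link set0U Fq -setI_eq0 set0I eqxx.
Qed.
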